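(* Let $0<q<1$ and $N\ge1$. $U_q(N)$ has property (NC), hence (LK). It has property (GC) if and only if $N=1$.
   Context: Fix $0<q<1$. For $N\ge1$, $U_q(N)$ is the unital complex algebra generated by $u_{jk}$ $(1\le j,k\le N)$ and $D^{-1}$ subject to: $u_{ij}u_{kj}=qu_{kj}u_{ij}$ for $i<k$; $u_{ij}u_{il}=qu_{il}u_{ij}$ for $j<l$; $u_{ij}u_{kl}=u_{kl}u_{ij}$ for $i<k,\ j>l$; $u_{ij}u_{kl}=u_{kl}u_{ij}-(q^{-1}-q)u_{il}u_{kj}$ for $i<k,\ j<l$; and $D^{-1}D=\mathbf 1=DD^{-1}$, where $D=\sum_{\sigma\in S_N}(-q)^{i(\sigma)}u_{1,\sigma(1)}\cdots u_{N,\sigma(N)}$ (a central element) and $i(\sigma)$ is the number of inversions of $\sigma$. It is a $*$-algebra with $u_{jk}^*=(-q)^{k-j}D^{jk}D^{-1}$ and $(D^{-1})^*=D$, where $D^{jk}$ is the quantum determinant (same formula as $D$, inversions counted with respect to the natural order of the remaining indices) of the matrix $(u_{il})$ with row $j$ and column $k$ removed. One has $\sum_su_{js}u_{ks}^*=\delta_{jk}\mathbf 1=\sum_su_{sj}^*u_{sk}$. The counit is the unital $*$-homomorphism $\varepsilon\colon U_q(N)\to\mathbb C$, $\varepsilon(u_{jk})=\delta_{jk}$, $\varepsilon(D^{-1})=1$. Put $K_n=\mathrm{span}\,(\ker\varepsilon)^n$; $K_1=\ker\varepsilon$. A generating functional is a linear functional $\psi$ that is hermitian, satisfies $\psi(\mathbf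 1)=0$, and $\psi(b^*b)\ge0$ for $b\in K_1$. A $*$-representation is a unital $*$-homomorphism $\pi\colon U_q(N)\to B(H)$ ($H=\{0\}$ allowed). A $\pi$-$\varepsilon$-cocycle is a linear map $\eta\colon U_q(N)\to H$ with $\eta(ab)=\pi(a)\eta(b)+\eta(a)\varepsilon(b)$; it is cyclic if its range is dense. A Schürmann triple $(\pi,\eta,\psi)$ consists of a $*$-representation $\pi$, a $\pi$-$\varepsilon$-cocycle $\eta$ and a linear functional $\psi$ with $\langle\eta(a),\eta(b)\rangle=\psi(a^*b)-\psi(a^* )\varepsilon(b)-\varepsilon(a^* )\psi(b)$ for all $a,b$. Every generating functional $\psi$ belongs to a Schürmann triple with cyclic $\eta$, unique up to unitary equivalence ( *the* Schürmann triple of $\psi$). A representation is gaussian if it vanishes on $K_1$; a cocycle is gaussian if it vanishes on $K_2$. A representation is completely non-gaussian if $\{0\}$ is the only invariant subspace on which it restricts to a gaussian representation. Given $\psi$ with Schürmann triple $(\pi,\eta,\psi)$, split $\pi=\pi_G\oplus\pi_{NG}$ with $\pi_G$ the restriction to $\bigcap_{a\in K_1}\ker\pi(a)$ and $\pi_{NG}$ the restriction to its orthogonal complement, and accordingly $\eta=\eta_G\oplus\eta_{NG}$. A Lévy-Khintchine decomposition of $\psi$ is $\psi=\psi_G+\psi_L$ with generating functionals such that $(\pi_G,\eta_G,\psi_G)$ and $(\pi_{NG},\eta_{NG},\psi_L)$ are Schürmann triples. Property (NC): for each completely non-gaussian $\pi$ and each $\pi$-$\varepsilon$-cocycle $\eta$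 there exists a Schürmann triple $(\pi,\eta,\psi)$. Property (GC): for each gaussian pair $(\pi,\eta)$ there exists a Schürmann triple $(\pi,\eta,\psi)$. Property (LK): every generating functional admits a Lévy-Khintchine decomposition. *)

(* Defs.v *)
(* The complex numbers are [R[i]] for an arbitrary [R : realType]. *)
From HB Require Import structures.
From mathcomp Require Import all_boot all_order all_algebra all_fingroup.
From mathcomp Require Import generic_quotient sesquilinear boolp reals complex.

Set Implicit Arguments.
Unset Strict Implicit.
Unset Printing Implicit Defensive.

Import Order.TTheory GRing.Theory Num.Theory.
Local Open Scope ring_scope.
Local Open Scope quotient_scope.

(** * Unital algebras given by generators and relations *)

Inductive term (K X : Type) : Type :=
| Cst of K
| Gen of X
| Add of term K X & term K X
| Mul of term K X & term K X.
Arguments Cst {K X}.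
Arguments Gen {K X}.
Arguments Add {K X}.
Arguments Mul {K X}.

HB.instance Definition _ (K X : Type) := gen_eqMixin (term K X).
HB.instance Definition _ (K X : Type) := gen_choiceMixin (term K X).

Section Presented.
Variables (K : comNzRingType) (X : Type) (rels : term K X -> term K X -> Prop).
Local Notation T := (term K X).

(* The least congruence containing [rels] whose quotient is a unital
   associative K-algebra; [Cst] becomes the structure map K -> algebra. *)
Inductive pres_eq : T -> T -> Prop :=
| pres_rel x y : rels x y -> pres_eq x y
| pres_refl x : pres_eq x x
| pres_sym x y : pres_eq x y -> pres_eq y x
| pres_trans y x z : pres_eq x y -> pres_eq y z -> pres_eq x z
| pres_add x x' y y' :
    pres_eq x x' -> pres_eq y y' -> pres_eq (Add x y) (Add x' y')
| pres_mul x x' y y' :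
    pres_eq x x' -> pres_eq y y' -> pres_eq (Mul x y) (Mul x' y')
| pres_addA x y z : pres_eq (Add x (Add y z)) (Add (Add x y) z)
| pres_addC x y : pres_eq (Add x y) (Add y x)
| pres_add0 x : pres_eq (Add (Cst 0) x) x
| pres_mulA x y z : pres_eq (Mul x (Mul y z)) (Mul (Mul x y) z)
| pres_mul1 x : pres_eq (Mul (Cst 1) x) x
| pres_mul0 x : pres_eq (Mul (Cst 0) x) (Cst 0)
| pres_mulDl x y z : pres_eq (Mul (Add x y) z) (Add (Mul x z) (Mul y z))
| pres_mulDr x y z : pres_eq (Mul x (Add y z)) (Add (Mul x y) (Mul x z))
| pres_cstD c d : pres_eq (Cst (c + d)) (Add (Cst c) (Cst d))
| pres_cstM c d : pres_eq (Cst (c * d)) (Mul (Cst c) (Cst d))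
| pres_cstC c x : pres_eq (Mul (Cst c) x) (Mul x (Cst c)).


Definition pres_eqb : rel T := fun x y => `[< pres_eq x y >].

Lemma pres_eqb_refl : reflexive pres_eqb.
Proof. by move=> x; apply/asboolP/pres_refl. Qed.
Lemma pres_eqb_sym : symmetric pres_eqb.
Proof. by move=> x y; apply/asboolP/asboolP; apply: pres_sym. Qed.
Lemma pres_eqb_trans : transitive pres_eqb.
Proof.
by move=> y x z /asboolP xy /asboolP yz; apply/asboolP/(pres_trans xy yz).
Qed.
Definition pres_equiv := EquivRel pres_eqb pres_eqb_refl pres_eqb_sym pres_eqb_trans.

Definition presented := {eq_quot pres_equiv}.
HB.instance Definition _ := Choice.on presented.

Definition cls (x : T) : presented := \pi_({eq_quot pres_equiv})%qT x.

Lemma clsP x y : cls x = cls y <-> pres_eq x y.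
Proof.
split=> [/eqmodP/asboolP //|xy].
by apply/eqmodP/asboolP.
Qed.

Lemma cls_surj (a : presented) : exists x, a = cls x.
Proof. by exists (repr a); rewrite /cls reprK. Qed.

Lemma repr_cls x : pres_eq (repr (cls x)) x.
Proof. by apply/clsP; rewrite /cls reprK. Qed.

Let addp (a b : presented) := cls (Add (repr a) (repr b)).
Let mulp (a b : presented) := cls (Mul (repr a) (repr b)).
Let scalep (c : K) (a : presented) := cls (Mul (Cst c) (repr a)).
Let oppp (a : presented) := scalep (- 1) a.

Let addpE x y : addp (cls x) (cls y) = cls (Add x y).
Proof. by apply/clsP/pres_add; apply: repr_cls. Qed.
Let mulpE x y : mulp (cls x) (cls y) = cls (Mul x y).
Proof. by apply/clsP/pres_mul; apply: repr_cls. Qed.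
Let scalepE c x : scalep c (cls x) = cls (Mul (Cst c) x).
Proof. by apply/clsP/pres_mul; [apply: pres_refl|apply: repr_cls]. Qed.

Let addpA : associative addp.
Proof.
move=> a b c; have [[[x ->] [y ->]] [z ->]] := (cls_surj a, cls_surj b, cls_surj c).
by rewrite !addpE; apply/clsP/pres_addA.
Qed.
Let addpC : commutative addp.
Proof.
move=> a b; have [[x ->] [y ->]] := (cls_surj a, cls_surj b).
by rewrite !addpE; apply/clsP/pres_addC.
Qed.
Let add0p : left_id (cls (Cst 0)) addp.
Proof.
by move=> a; have [x ->] := cls_surj a; rewrite addpE; apply/clsP/pres_add0.
Qed.
Let scalepDl a : {morph scalep^~ a : c d / c + d >-> addp c d}.
Proof.
move=> c d; have [x ->] := cls_surj a; rewrite !scalepE addpE; apply/clsP.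
apply: pres_trans (pres_mulDl _ _ _).
by apply: pres_mul (pres_refl _); apply: pres_cstD.
Qed.
Let scale1p : left_id 1 scalep.
Proof.
by move=> a; have [x ->] := cls_surj a; rewrite scalepE; apply/clsP/pres_mul1.
Qed.
Let addNp : left_inverse (cls (Cst 0)) oppp addp.
Proof.
move=> a; rewrite -[X in addp _ X]scale1p -scalepDl addNr.
by have [x ->] := cls_surj a; rewrite scalepE; apply/clsP/pres_mul0.
Qed.
Let mulpA : associative mulp.
Proof.
move=> a b c; have [[[x ->] [y ->]] [z ->]] := (cls_surj a, cls_surj b, cls_surj c).
by rewrite !mulpE; apply/clsP/pres_mulA.
Qed.
Let mul1p : left_id (cls (Cst 1)) mulp.
Proof.
by move=> a; have [x ->] := cls_surj a; rewrite mulpE; apply/clsP/pres_mul1.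
Qed.
Let mulp1 : right_id (cls (Cst 1)) mulp.
Proof.
move=> a; have [x ->] := cls_surj a; rewrite mulpE; apply/clsP.
by apply: pres_trans (pres_mul1 _); apply/pres_sym/pres_cstC.
Qed.
Let mulpDl : left_distributive mulp addp.
Proof.
move=> a b c; have [[[x ->] [y ->]] [z ->]] := (cls_surj a, cls_surj b, cls_surj c).
by rewrite !(mulpE, addpE); apply/clsP/pres_mulDl.
Qed.
Let mulpDr : right_distributive mulp addp.
Proof.
move=> a b c; have [[[x ->] [y ->]] [z ->]] := (cls_surj a, cls_surj b, cls_surj c).
by rewrite !(mulpE, addpE); apply/clsP/pres_mulDr.
Qed.

HB.instance Definition _ :=
  GRing.isPzRing.Build presented addpA addpC add0p addNp mulpA mul1p mulp1
    mulpDl mulpDr.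

Let scalepA c d a : scalep c (scalep d a) = scalep (c * d) a.
Proof.
have [x ->] := cls_surj a; rewrite !scalepE; apply/clsP.
apply: pres_trans (pres_mulA _ _ _) _.
by apply: pres_mul (pres_refl _); apply/pres_sym/pres_cstM.
Qed.
Let scalepDr : right_distributive scalep +%R.
Proof.
move=> c a b; have [[x ->] [y ->]] := (cls_surj a, cls_surj b).
by rewrite -[_ + _]/(addp _ _) -[RHS]/(addp _ _) !(addpE, scalepE);
  apply/clsP/pres_mulDr.
Qed.

HB.instance Definition _ :=
  GRing.Zmodule_isLmodule.Build K presented scalepA scale1p scalepDr scalepDl.

Lemma clsD x y : cls (Add x y) = cls x + cls y.
Proof. by rewrite -[RHS]/(addp _ _) addpE. Qed.
Lemma clsM x y : cls (Mul x y) = cls x * cls y.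
Proof. by rewrite -[RHS]/(mulp _ _) mulpE. Qed.
Lemma clsC c : cls (Cst c) = c *: (1 : presented).
Proof.
by rewrite -[RHS]/(scalep c (cls (Cst 1))) scalepE -[RHS]mulpE; symmetry; apply: mulp1.
Qed.

Lemma presented_scaleAl (c : K) (a b : presented) : c *: (a * b) = (c *: a) * b.
Proof.
have [[x ->] [y ->]] := (cls_surj a, cls_surj b).
by rewrite -[_ * _]/(mulp _ _) -[RHS]/(mulp _ _)
  -[c *: cls _]/(scalep _ _) -[LHS]/(scalep _ _) !(mulpE, scalepE);
  apply/clsP/pres_mulA.
Qed.
Lemma presented_scaleAr (c : K) (a b : presented) : c *: (a * b) = a * (c *: b).
Proof.
have [[x ->] [y ->]] := (cls_surj a, cls_surj b).
rewrite -[_ * _]/(mulp _ _) -[RHS]/(mulp _ _)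
  -[c *: cls _]/(scalep _ _) -[LHS]/(scalep _ _) !(mulpE, scalepE).
apply/clsP.
apply: pres_trans (pres_mulA _ _ _) _; apply: pres_trans (pres_sym (pres_mulA _ _ _)).
by apply: pres_mul (pres_refl _); apply: pres_cstC.
Qed.
End Presented.

(* Evaluation of terms at a family of elements of a K-algebra, and the induced
   map on the presented algebra. *)
Section Evaluation.
Variables (K : comNzRingType) (X : Type) (A : algType K) (f : X -> A).

Fixpoint evalt (x : term K X) : A :=
  match x with
  | Cst c => c%:A
  | Gen i => f i
  | Add y z => evalt y + evalt z
  | Mul y z => evalt y * evalt z
  end.

Variable rels : term K X -> term K X -> Prop.
Definition pres_lift (a : presented rels) : A := evalt (repr a).

Hypothesis f_rel : forall x y, rels x y -> evalt x = evalt y.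

Lemma evalt_eq x y : pres_eq rels x y -> evalt x = evalt y.
Proof.
elim=> {x y} //=.
- by move=> y x z _ -> _ ->.
- by move=> x x' y y' _ -> _ ->.
- by move=> x x' y y' _ -> _ ->.
- by move=> x y z; rewrite addrA.
- by move=> x y; rewrite addrC.
- by move=> x; rewrite scale0r add0r.
- by move=> x y z; rewrite mulrA.
- by move=> x; rewrite scale1r mul1r.
- by move=> x; rewrite scale0r mul0r.
- by move=> x y z; rewrite mulrDl.
- by move=> x y z; rewrite mulrDr.
- by move=> c d; rewrite scalerDl.
- by move=> c d; rewrite -scalerAl mul1r scalerA.
- by move=> c x; rewrite mulr_algl mulr_algr.
Qed.

Lemma pres_liftE x : pres_lift (cls rels x) = evalt x.
Proof. exact/evalt_eq/repr_cls. Qed.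
End Evaluation.

(** * The algebra U_q(N) *)

Definition inversions n (s : 'S_n) : nat :=
  #|[set p : 'I_n * 'I_n | (p.1 < p.2)%N && (s p.2 < s p.1)%N]|.

Section Uq.
Variables (R : realType) (q : R) (N : nat).
Local Notation C := R[i].
Local Notation qC := (real_complex R q : C).

Inductive uq_gen : Type :=
| UGen of 'I_N & 'I_N
| UDetInv.

Local Notation T := (term C uq_gen).
Local Notation u i j := (Gen (UGen i j) : T).
Local Notation Dinv := (Gen UDetInv : T).
Local Notation "x *t y" := (Mul x y) (at level 40, left associativity).

Definition uq_det_term : T :=
  \big[Add/Cst 0]_(s : 'S_N)
    (Cst ((- qC) ^+ inversions s) *t \big[Mul/Cst 1]_(i < N) u i (s i)).

Inductive uq_rel : T -> T -> Prop :=
| uq_col (i j k : 'I_N) : (i < k)%N ->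
    uq_rel (u i j *t u k j) (Cst qC *t (u k j *t u i j))
| uq_row (i j l : 'I_N) : (j < l)%N ->
    uq_rel (u i j *t u i l) (Cst qC *t (u i l *t u i j))
| uq_comm (i j k l : 'I_N) : (i < k)%N -> (l < j)%N ->
    uq_rel (u i j *t u k l) (u k l *t u i j)
| uq_cross (i j k l : 'I_N) : (i < k)%N -> (j < l)%N ->
    uq_rel (u i j *t u k l)
      (Add (u k l *t u i j) (Cst (- (qC^-1 - qC)) *t (u i l *t u k j)))
| uq_detVl : uq_rel (Dinv *t uq_det_term) (Cst 1)
| uq_detVr : uq_rel (uq_det_term *t Dinv) (Cst 1).

Definition Uq : Type := presented uq_rel.
HB.instance Definition _ := GRing.PzRing.on Uq.
HB.instance Definition _ := GRing.Lmodule.on Uq.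

Definition counit_gen (g : uq_gen) : C^o :=
  if g is UGen i j then (i == j)%:R else 1.

Lemma inversions1 : inversions (1%g : 'S_N) = 0%N.
Proof.
apply/eqP; rewrite cards_eq0; apply/eqP/setP=> p; rewrite !inE !perm1.
by apply/negP => /andP[/ltn_trans h /h]; rewrite ltnn.
Qed.

Lemma counit_det : evalt counit_gen uq_det_term = 1.
Proof.
rewrite /uq_det_term (big_morph (evalt counit_gen) (id1 := 0) (op1 := +%R)) //;
  last by rewrite /= scale0r.
rewrite (bigD1 (1%g : 'S_N)) //= inversions1 expr0 scale1r mul1r.
have prodE (s : 'S_N) : evalt counit_gen (\big[Mul/Cst 1]_(i < N) u i (s i)) =
    \prod_(i < N) (i == s i)%:R.
  by apply: (big_morph (evalt counit_gen)) => //=; rewrite scale1r.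
rewrite prodE big1 => [|i _]; last by rewrite perm1 eqxx.
rewrite big1 ?addr0 // => s s_neq1; rewrite prodE.
have [i si] : exists i, s i != i.
  apply/existsP; apply: contraNT s_neq1 => /existsPn s1.
  by apply/eqP/permP => i; rewrite perm1; apply/eqP; rewrite -[_ == _]negbK s1.
by rewrite (bigD1 i) //= eq_sym (negPf si) mul0r mulr0.
Qed.

Lemma counit_rel x y : uq_rel x y -> evalt counit_gen x = evalt counit_gen y.
Proof.
have delta (a b c d : 'I_N) : (a == b -> c == d -> False) ->
    (a == b)%:R * (c == d)%:R = 0 :> C^o.
  move=> F; have [ab|_] := a =P b; last by rewrite mul0r.
  by have [cd|_] := c =P d; [case: F; apply/eqP | rewrite mulr0].
case=> {x y} /= [i j k ik|i j l jl|i j k l ik lj|i j k l ik jl| |];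
  rewrite ?counit_det ?mulr1 ?scale1r //.
- rewrite !delta ?mulr0 // => /eqP E /eqP F; move: ik; rewrite ?E ?F ltnn //.
- rewrite !delta ?mulr0 // => /eqP E /eqP F; move: jl; rewrite -?E -?F ltnn //.
- by rewrite mulrC.
- rewrite [X in _ + _ * X]delta ?mulr0 ?addr0 1?mulrC // => /eqP E /eqP F.
  by move: ik; rewrite E F => /ltn_trans /(_ jl); rewrite ltnn.
Qed.

Lemma Uq_nontrivial : (1 : Uq) != 0.
Proof.
apply/eqP => /(congr1 (@pres_lift _ _ _ counit_gen uq_rel)).
rewrite -[1 : Uq]/(cls uq_rel (Cst 1)) -[0 : Uq]/(cls uq_rel (Cst 0)).
rewrite !(pres_liftE counit_rel) /= scale0r scale1r => /eqP.
by rewrite oner_eq0.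
Qed.

HB.instance Definition _ := GRing.PzSemiRing_isNonZero.Build Uq Uq_nontrivial.
HB.instance Definition _ :=
  GRing.Lmodule_isLalgebra.Build C Uq (@presented_scaleAl _ _ uq_rel).
HB.instance Definition _ :=
  GRing.Lalgebra_isAlgebra.Build C Uq (@presented_scaleAr _ _ uq_rel).

Definition uq_u (i j : 'I_N) : Uq := cls uq_rel (u i j).
Definition uq_detV : Uq := cls uq_rel Dinv.
Definition uq_counit : Uq -> C := @pres_lift _ _ _ counit_gen uq_rel.
End Uq.

Section UqTheory.
Variables (R : realType) (q : R) (N : nat).
Local Notation C := R[i].
Local Notation U := (Uq q N).
Local Notation qC := (real_complex R q : C).
Local Notation uu := (@uq_u R q N).
Local Notation eps := (@uq_counit R q N).

Lemma uq_counit_cls x : eps (cls (uq_rel q (N:=N)) x) = evalt (@counit_gen R N) x.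
Proof. exact: (pres_liftE (@counit_rel R q N)). Qed.

Lemma uq_counit_u i j : eps (uu i j) = (i == j)%:R.
Proof. exact: uq_counit_cls. Qed.

Lemma uq_counit_detV : eps (uq_detV q N) = 1.
Proof. exact: uq_counit_cls. Qed.

Fact uq_counit_linear : scalar eps.
Proof.
move=> c a b; have [[x ->] [y ->]] := (cls_surj a, cls_surj b).
have <- : cls (uq_rel q (N:=N)) (Add (Mul (Cst c) x) y) =
    c *: cls (uq_rel q (N:=N)) x + cls (uq_rel q (N:=N)) y.
  by rewrite clsD clsM clsC -presented_scaleAl mul1r.
by rewrite !uq_counit_cls /= -scalerAl mul1r.
Qed.

Fact uq_counit_monoid : monoid_morphism eps.
Proof.
split=> [|a b]; first by rewrite [LHS](uq_counit_cls (Cst 1)) /= scale1r.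
have [[x ->] [y ->]] := (cls_surj a, cls_surj b).
by rewrite -clsM !uq_counit_cls.
Qed.

HB.instance Definition _ := GRing.isLinear.Build C U C *%R eps uq_counit_linear.
HB.instance Definition _ := GRing.isMonoidMorphism.Build U C eps uq_counit_monoid.

(* The quantum determinant of an n x n matrix with entries in U_q(N). *)
Definition qdet n (M : 'I_n -> 'I_n -> U) : U :=
  \sum_(s : 'S_n) (- qC) ^+ inversions s *: \prod_(i < n) M i (s i).

Definition uq_det : U := qdet uu.

(* [lift j] enumerates the indices different from [j] in increasing order. *)
Definition uq_minor (j k : 'I_N) : U :=
  qdet (fun a b : 'I_N.-1 => uu (lift j a) (lift k b)).

Lemma uq_detE : uq_det = cls (uq_rel q (N:=N)) (uq_det_term q N).
Proof.
rewrite /uq_det_term (big_morph (cls _) (id1 := 0) (op1 := +%R)) //; last exact: clsD.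
apply: eq_bigr => s _; rewrite clsM clsC.
rewrite -presented_scaleAl mul1r; congr (_ *: _).
by rewrite (big_morph (cls _) (id1 := 1) (op1 := *%R)) //; exact: clsM.
Qed.

(* The *-structure of U_q(N): the values on the generators determine it, see
   [uq_star_unique]. *)
Record uq_star := UqStar {
  star :> U -> U;
  starD : forall a b, star (a + b) = star a + star b;
  starZ : forall (c : C) a, star (c *: a) = (c^*)%R *: star a;
  starM : forall a b, star (a * b) = star b * star a;
  starK : involutive star;
  star_u : forall j k : 'I_N,
    star (uu j k) = ((- qC) ^ (k%:Z - j%:Z)) *: (uq_minor j k * uq_detV q N);
  star_detV : star (uq_detV q N) = uq_det
}.

Lemma uq_star_unique (s t : uq_star) : star s =1 star t.
Proof.
have star1 (r : uq_star) : r 1 = 1.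
  by rewrite -[LHS]mulr1 -{2}[1](starK r) -starM mulr1 starK.
move=> a; have [x ->] := cls_surj a; elim: x => [c|[i j|]|x IHx y IHy|x IHx y IHy].
- by rewrite clsC !starZ !star1.
- by rewrite [LHS]star_u [RHS]star_u.
- by rewrite [LHS]star_detV [RHS]star_detV.
- by rewrite clsD !starD IHx IHy.
- by rewrite clsM !starM IHx IHy.
Qed.
End UqTheory.

(** * Hilbert spaces and bounded operators *)

Section Convergence.
Variables (R : realType) (H : lmodType R[i]) (dot : {dot H for Num.Def.conjC}).

Definition dot_norm (x : H) : R[i] := sqrtC (dot x x).

(* As an inequality [0 < e] in R[i] forces [e] to be real, [e] ranges over the
   positive reals. *)
Definition dot_cauchy (x : nat -> H) : Prop :=
  forall e : R[i], 0 < e -> exists n0, forall m n, (n0 <= m)%N -> (n0 <= n)%N ->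
    dot_norm (x m - x n) < e.

Definition dot_cvg (x : nat -> H) (l : H) : Prop :=
  forall e : R[i], 0 < e -> exists n0, forall n, (n0 <= n)%N ->
    dot_norm (x n - l) < e.
End Convergence.

Record hilbert (R : realType) := Hilbert {
  hcarrier :> lmodType R[i];
  hdot : {dot hcarrier for Num.Def.conjC};
  hcomplete : forall x : nat -> hcarrier,
    dot_cauchy hdot x -> exists l, dot_cvg hdot x l
}.

Section HilbertTheory.
Variables (R : realType) (H : hilbert R).
Local Notation C := R[i].

(* [hdot] is linear in its first argument; [inner] is linear in the second. *)
Definition inner (x y : H) : C := hdot H y x.
Definition hnorm (x : H) : C := dot_norm (hdot H) x.
Definition hcvg (x : nat -> H) (l : H) : Prop := dot_cvg (hdot H) x l.

Definition bounded_op (f : H -> H) : Prop :=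
  linear f /\ exists2 M : C, 0 <= M & forall x, hnorm (f x) <= M * hnorm x.

Lemma innerC x y : inner x y = (inner y x)^*%R.
Proof. by rewrite /inner [LHS]hermC /= expr0 mul1r. Qed.
Lemma innerDr x y z : inner x (y + z) = inner x y + inner x z.
Proof. exact: linearDl. Qed.
Lemma innerBr x y z : inner x (y - z) = inner x y - inner x z.
Proof. exact: linearBl. Qed.
Lemma innerZr c x y : inner x (c *: y) = c * inner x y.
Proof. exact: linearZl_LR. Qed.
Lemma inner0r x : inner x 0 = 0.
Proof. by rewrite /inner linear0l. Qed.
Lemma inner_ge0 x : 0 <= inner x x.
Proof. exact: dnorm_ge0. Qed.
Lemma hnorm_ge0 x : 0 <= hnorm x.
Proof. by rewrite sqrtC_ge0; exact: dnorm_ge0. Qed.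
Lemma hnorm_eq0 x : hnorm x = 0 -> x = 0.
Proof. by move=> /eqP; rewrite sqrtC_eq0 => /eqP h; apply/eqP; rewrite -(dnorm_eq0 (hdot H)) h. Qed.
Lemma hnorm_opp x : hnorm (- x) = hnorm x.
Proof. by congr sqrtC; exact: (hnormN (hdot H)). Qed.

Lemma cauchy_schwarz x y : `|inner x y| <= hnorm x * hnorm y.
Proof.
have [->|x0] := eqVneq x 0.
  by rewrite innerC inner0r rmorph0 normr0 mulr_ge0 ?hnorm_ge0.
rewrite -(ler_pXn2r (n := 2)) ?nnegrE ?mulr_ge0 ?hnorm_ge0 ?normr_ge0 //.
rewrite exprMn !sqrtCK.
have xx : 0 < hdot H x x by rewrite dnorm_gt0.
set p := hdot H y x; set n := hdot H x x in xx *.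
have n_conj : n^* = n by apply: geC0_conj; apply: ltW.
have := dnorm_ge0 (hdot H) (y - (p / n) *: x).
rewrite dnormB dnormZ -/n linearZr_LR /= -/p.
have -> : (p / n)^* * p = `|p| ^+ 2 / n.
  by rewrite rmorphM /= fmorphV /= n_conj mulrAC [_ * p]mulrC -normCK.
have -> : (`|p| ^+ 2 / n)^* = `|p| ^+ 2 / n.
  by apply: geC0_conj; rewrite divr_ge0 ?exprn_ge0 // ltW.
rewrite normf_div exprMn exprVn [`|n|]gtr0_norm // [n ^+ 2]expr2 invfM.
rewrite mulrA divfK ?gt_eqF // opprD addrA addrK subr_ge0 ler_pdivrMr //.
by rewrite mulrC.
Qed.
End HilbertTheory.
Arguments inner {R} H.
Arguments hnorm {R H}.

(* A closed linear subspace, and the Hilbert space it forms. *)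
Record csub (R : realType) (H : hilbert R) := CSub {
  csub_pred :> {pred H};
  csub_submod : subsemimod_closed csub_pred;
  csub_closed : forall (x : nat -> H) (l : H),
    (forall n, x n \in csub_pred) -> hcvg x l -> l \in csub_pred
}.

Section SubHilbert.
Variables (R : realType) (H : hilbert R) (V : csub H).
Local Notation C := R[i].

HB.instance Definition _ :=
  GRing.isSubmodClosed.Build C (hcarrier H) (csub_pred V) (csub_submod V).

Record csub_type := CSubType { csub_val : H; _ : csub_val \in csub_pred V }.
HB.instance Definition _ := [isSub for csub_val].
HB.instance Definition _ := [Choice of csub_type by <:].
HB.instance Definition _ := [SubChoice_isSubLmodule of csub_type by <:].

Definition csub_dot (x y : csub_type) : C := hdot H (val x) (val y).

Fact csub_dot_bilinear :
  bilinear_for ( *%R : GRing.Scale.law C C) (Num.Def.conjC \; *%R : GRing.Scale.law C C) csub_dot.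
Proof.
split=> [x|x] c y z; rewrite /csub_dot linearP /=.
  by rewrite linearDl linearZl_LR.
by [].
Qed.
HB.instance Definition _ := bilinear_isBilinear.Build C csub_type csub_type C
  ( *%R : GRing.Scale.law C C) (Num.Def.conjC \; *%R) csub_dot csub_dot_bilinear.

Fact csub_dot_hermitian x y :
  csub_dot x y = (-1) ^+ false * Num.Def.conjC (csub_dot y x).
Proof. exact: hermC. Qed.
HB.instance Definition _ := isHermitianSesquilinear.Build C csub_type false
  Num.Def.conjC csub_dot csub_dot_hermitian.

Fact csub_dot_gt0 x : x != 0 -> 0 < csub_dot x x.
Proof. by move=> x0; rewrite /csub_dot dnorm_gt0 -(inj_eq val_inj) in x0 *. Qed.
HB.instance Definition _ := isDotProduct.Build C csub_type csub_dot csub_dot_gt0.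

Lemma csub_norm x : dot_norm csub_dot x = hnorm (val x).
Proof. by []. Qed.

Fact csub_complete (x : nat -> csub_type) :
  dot_cauchy csub_dot x -> exists l, dot_cvg csub_dot x l.
Proof.
move=> xC; have [|l xl] := @hcomplete R H (val \o x).
  move=> e /xC[n0 h]; exists n0 => m n m0 n0'; have := h m n m0 n0'.
  by rewrite csub_norm raddfB.
have Vl : l \in csub_pred V by apply: (csub_closed _ xl) => n; exact: valP.
exists (CSubType Vl) => e /xl[n0 h]; exists n0 => n /h.
by rewrite csub_norm raddfB.
Qed.

Definition csub_hilbert : hilbert R := Hilbert csub_complete.
End SubHilbert.

Coercion csub_hilbert : csub >-> hilbert.

Section Orthogonal.
Variables (R : realType) (H : hilbert R).

Definition orth_pred (V : csub H) : {pred H} :=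
  fun x => `[< forall y, y \in csub_pred V -> inner H y x = 0 >].

Fact orth_submod V : subsemimod_closed (orth_pred V).
Proof.
split=> [|c x /asboolP x0]; last first.
  by apply/asboolP=> y Vy; rewrite innerZr x0 // mulr0.
split=> [|x z /asboolP x0 /asboolP z0]; apply/asboolP => y Vy; first exact: inner0r.
by rewrite innerDr x0 // z0 // addr0.
Qed.

Fact orth_closed V (x : nat -> H) (l : H) :
  (forall n, x n \in orth_pred V) -> hcvg x l -> l \in orth_pred V.
Proof.
move=> xV xl; apply/asboolP=> y Vy; apply: contrapT => /eqP yl.
have y0 : hnorm y != 0.
  apply: contra yl => /eqP/hnorm_eq0 ->.
  by rewrite innerC inner0r rmorph0.
have y_gt0 : 0 < hnorm y by rewrite lt_def y0 hnorm_ge0.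
have [|n0 /(_ _ (leqnn n0)) h] := xl (`|inner H y l| / hnorm y).
  by rewrite divr_gt0 // normr_gt0.
have := cauchy_schwarz y (x n0 - l).
rewrite innerBr.
have /asboolP -> // := xV n0.
rewrite sub0r normrN mulrC -ler_pdivrMr // => /le_lt_trans /(_ h).
by rewrite ltxx.
Qed.

Definition orth V : csub H := CSub (orth_submod V) (@orth_closed V).
End Orthogonal.

(** * Schürmann triples on U_q(N) *)

Section Schurmann.
Variables (R : realType) (q : R) (N : nat) (st : uq_star q N).
Local Notation C := R[i].
Local Notation U := (Uq q N).
Local Notation eps := (@uq_counit R q N).

(* K_n, the linear span of the n-fold products of elements of ker eps. *)
Definition K (n : nat) (a : U) : Prop :=
  exists m (c : 'I_m -> C) (b : 'I_m -> 'I_n -> U),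
    (forall i j, eps (b i j) = 0) /\
    a = \sum_(i < m) c i *: \prod_(j < n) b i j.

Lemma K1P a : K 1 a <-> eps a = 0.
Proof.
split=> [[m [c [b [b0 ->]]]]|a0].
  rewrite raddf_sum big1 // => i _.
  by rewrite /= linearZ /= big_ord1 b0 mulr0.
exists 1%N, (fun=> 1), (fun _ _ => a); split=> //.
by rewrite !big_ord1 scale1r.
Qed.

Definition hermitian_functional (psi : {scalar U}) : Prop :=
  forall a, psi (st a) = ((psi a)^*)%R.

Definition generating_functional (psi : {scalar U}) : Prop :=
  [/\ hermitian_functional psi, psi 1 = 0 &
      forall b, K 1 b -> 0 <= psi (st b * b)].

Record is_star_rep (H : hilbert R) (pi : U -> H -> H) : Prop := IsStarRep {
  rep_bounded : forall a, bounded_op (pi a);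
  rep_linear : forall (c : C) a b x, pi (c *: a + b) x = c *: pi a x + pi b x;
  rep1 : forall x, pi 1 x = x;
  repM : forall a b x, pi (a * b) x = pi a (pi b x);
  rep_star : forall a x y, inner H (pi a x) y = inner H x (pi (st a) y)
}.

Record star_rep (H : hilbert R) := StarRep {
  rep :> U -> H -> H;
  rep_is_star_rep : is_star_rep rep
}.

Definition cocycle (H : hilbert R) (pi : star_rep H) (eta : {linear U -> H}) : Prop :=
  forall a b, eta (a * b) = pi a (eta b) + eps b *: eta a.

Definition cyclic (H : hilbert R) (eta : {linear U -> H}) : Prop :=
  forall (x : H) (e : C), 0 < e -> exists a, hnorm (x - eta a) < e.

Definition schurmann_triple (H : hilbert R) (pi : star_rep H) (eta : {linear U -> H})
    (psi : {scalar U}) : Prop :=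
  cocycle pi eta /\
  forall a b, inner H (eta a) (eta b) =
    psi (st a * b) - psi (st a) * eps b - eps (st a) * psi b.

Definition gaussian_rep (H : hilbert R) (pi : star_rep H) : Prop :=
  forall a, K 1 a -> forall x, pi a x = 0.

Definition gaussian_cocycle (H : hilbert R) (eta : {linear U -> H}) : Prop :=
  forall a, K 2 a -> eta a = 0.

Definition invariant (H : hilbert R) (pi : star_rep H) (V : csub H) : Prop :=
  forall a x, x \in csub_pred V -> pi a x \in csub_pred V.

(* On an invariant subspace the default value of [insubd] is never used. *)
Definition restr_fun (H : hilbert R) (pi : star_rep H) (V : csub H) : U -> V -> V :=
  fun a x => insubd (0 : V) (pi a (val x)).

Section Restriction.
Variables (H : hilbert R) (pi : star_rep H) (V : csub H) (Vpi : invariant pi V).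

Lemma restr_funE a x : val (restr_fun pi a x : V) = pi a (val x).
Proof. by rewrite val_insubd Vpi //; exact: valP. Qed.

Fact restr_is_star_rep : is_star_rep (@restr_fun H pi V).
Proof.
have [bnd lin p1 pM ps] := rep_is_star_rep pi.
split.
- move=> a; have [la [M M0 aM]] := bnd a; split=> [c x y|].
    by apply: val_inj; rewrite linearP /= !restr_funE -la -linearP.
  by exists M => // x; have := aM (val x); rewrite -restr_funE.
- by move=> c a b x; apply: val_inj; rewrite linearP /= !restr_funE lin.
- by move=> x; apply: val_inj; rewrite restr_funE p1.
- by move=> a b x; apply: val_inj; rewrite !restr_funE pM.
- move=> a x y; have := ps a (val x) (val y).
  by rewrite -!restr_funE.
Qed.

Definition restr : star_rep V := StarRep restr_is_star_rep.
End Restriction.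

Definition completely_nongaussian (H : hilbert R) (pi : star_rep H) : Prop :=
  forall (V : csub H) (Vpi : invariant pi V),
    gaussian_rep (restr Vpi) -> forall x, x \in csub_pred V -> x = 0.

Section GaussianPart.
Variables (H : hilbert R) (pi : star_rep H).

Definition gauss_pred : {pred H} :=
  fun x => `[< forall a, K 1 a -> pi a x = 0 >].

Fact gauss_submod : subsemimod_closed gauss_pred.
Proof.
have piD a x y c : pi a (c *: x + y) = c *: pi a x + pi a y.
  by have [la _] := rep_bounded (rep_is_star_rep pi) a; rewrite la.
have pi0 a : pi a 0 = 0.
  have := piD a 0 0 1; rewrite !scale1r addr0 => /eqP.
  by rewrite -subr_eq0 opprD addrA subrr sub0r oppr_eq0 => /eqP.
split=> [|c x /asboolP x0]; last first.
  by apply/asboolP=> a Ka; rewrite -[c *: x]addr0 piD x0 // pi0 scaler0 addr0.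
split=> [|x y /asboolP x0 /asboolP y0]; apply/asboolP => a Ka //.
by rewrite -[x]scale1r piD x0 // y0 // scaler0 addr0.
Qed.

Fact gauss_closed (x : nat -> H) (l : H) :
  (forall n, x n \in gauss_pred) -> hcvg x l -> l \in gauss_pred.
Proof.
move=> xG xl; apply/asboolP=> a Ka; apply: contrapT => pal.
have [la [M M0 aM]] := rep_bounded (rep_is_star_rep pi) a.
have al_gt0 : 0 < hnorm (pi a l).
  by rewrite lt_def hnorm_ge0 andbT; apply/eqP => /hnorm_eq0.
have M_gt0 : 0 < M.
  rewrite lt_def M0 andbT; apply/eqP => M00; have := aM l.
  by rewrite M00 mul0r => /(lt_le_trans al_gt0); rewrite ltxx.
have [|n0 /(_ _ (leqnn n0)) h] := xl (hnorm (pi a l) / M).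
  by rewrite divr_gt0.
have E : pi a (x n0 - l) = - pi a l.
  have /asboolP xn0 := xG n0.
  by rewrite addrC -scaleN1r la xn0 // addr0 scaleN1r.
have := aM (x n0 - l).
rewrite E hnorm_opp mulrC -ler_pdivrMr // => /le_lt_trans /(_ h).
by rewrite ltxx.
Qed.

(* The intersection of the kernels of pi(a), for a in K_1. *)
Definition gauss_part : csub H := CSub gauss_submod gauss_closed.

Lemma gauss_invariant : invariant pi gauss_part.
Proof.
move=> b x /asboolP x0; apply/asboolP => a /K1P a0.
rewrite -(repM (rep_is_star_rep pi)); apply/x0/K1P.
by rewrite rmorphM /= a0 mul0r.
Qed.

Lemma orth_invariant (V : csub H) : invariant pi V -> invariant pi (orth V).
Proof.
move=> Vpi a x /asboolP x0; apply/asboolP => y Vy.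
by rewrite -[a](starK st) -(rep_star (rep_is_star_rep pi)) x0 // Vpi.
Qed.
End GaussianPart.

(* [psi = psiG + psiL] is a decomposition along the splitting of H into
   [gauss_part pi] and its orthogonal complement; [etaG] and [etaNG] are the
   components of [eta]. *)
Definition levy_khintchine_decomposition (H : hilbert R) (pi : star_rep H)
    (eta : {linear U -> H}) (psi psiG psiL : {scalar U}) : Prop :=
  let Hg := gauss_part pi in
  let piG := restr (@gauss_invariant H pi) in
  let piNG := restr (orth_invariant (@gauss_invariant H pi)) in
  [/\ generating_functional psiG, generating_functional psiL,
      (forall a, psi a = psiG a + psiL a) &
      exists (etaG : {linear U -> csub_hilbert Hg})
             (etaNG : {linear U -> csub_hilbert (orth Hg)}),
        [/\ forall a, eta a = csub_val (etaG a) + csub_val (etaNG a),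
            schurmann_triple piG etaG psiG &
            schurmann_triple piNG etaNG psiL]].

Definition property_NC : Prop :=
  forall (H : hilbert R) (pi : star_rep H) (eta : {linear U -> H}),
    completely_nongaussian pi -> cocycle pi eta ->
    exists psi : {scalar U}, schurmann_triple pi eta psi.

Definition property_GC : Prop :=
  forall (H : hilbert R) (pi : star_rep H) (eta : {linear U -> H}),
    gaussian_rep pi -> cocycle pi eta -> gaussian_cocycle eta ->
    exists psi : {scalar U}, schurmann_triple pi eta psi.

(* The triple with cyclic cocycle is determined by [psi] up to unitary
   equivalence. *)
Definition property_LK : Prop :=
  forall psi : {scalar U}, generating_functional psi ->
  forall (H : hilbert R) (pi : star_rep H) (eta : {linear U -> H}),
    schurmann_triple pi eta psi -> cyclic eta ->
    exists psiG psiL : {scalar U},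
      levy_khintchine_decomposition pi eta psi psiG psiL.
End Schurmann.

(* Main.v *)
(* A functional psi of a triple satisfies psi(ab) = eps(a) psi(b) + psi(a) eps(b) +
   <eta(a^* ), eta(b)>, and for a coboundary eta(a) = (pi(a) - eps(a)) h one may take
   psi(a) = <h, (pi(a) - eps(a)) h>. For completely non-gaussian pi every cocycle is a
   pointwise limit of coboundaries: T = pi(u_NN) is a contraction, since
   sum_s u_Ns u_Ns^* = 1 by the quantum Laplace expansion, and the mean ergodic theorem
   gives polynomials p_n with (1 - T) p_n(T) -> 1 - P, P the projection onto the fixed
   space of T. With h_n = - p_n(T) eta(u_NN) the coboundaries converge, as u_NN q-commutes
   with its row and column and commutes with the 2 x 2 quantum minors
   u_ij u_NN - q u_iN u_Nj. The remainder lives where u_NN acts as 1, and one continues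
   with the next diagonal entry. The functionals of the coboundaries, normalized to vanish
   on the u_ii by subtracting derivations, converge to psi, which is (NC). Splitting off
   the gaussian part orthogonally gives (LK). For gaussian pi, a cocycle is a combination of the
   derivations d_m; when N = 1 the second order term of the character u |-> 1 + J is a
   functional, whereas for N >= 2 the commutation of u_11 and u_22 modulo off-diagonal
   terms would force <v_1, v_2> to be real. *)
Require Import Defs.
From HB Require Import structures.
From mathcomp Require Import all_boot all_order all_algebra all_fingroup.
From mathcomp Require Import classical_sets sesquilinear boolp reals complex zify ring lra.

Set Implicit Arguments.
Unset Strict Implicit.
Unset Printing Implicit Defensive.

Import Order.TTheory GRing.Theory Num.Theory.
Local Open Scope ring_scope.

(** * Inversions of permutations and ordered products *)

Lemma inversions_sum n (s : 'S_n) :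
  inversions s = (\sum_(i < n) \sum_(j < n) ((i < j) && (s j < s i)))%N.
Proof.
rewrite /inversions -sum1_card big_mkcond pair_big /=.
by apply: eq_bigr => -[i j] _; rewrite inE /=; case: ifP.
Qed.

(** Position 0 forms an inversion with exactly the positions whose value lies below [i]. Since
    [lift] preserves the order, all other pairs contribute the inversions of [s]. *)
Lemma inversions_lift0 n (i : 'I_n.+1) (s : 'S_n) :
  inversions (lift_perm ord0 i s) = (i + inversions s)%N.
Proof.
rewrite !inversions_sum big_ord_recl /=; congr addn.
  rewrite big_ord_recl /= add0n lift_perm_id.
  under eq_bigr => j _ do rewrite lift_perm_lift.
  rewrite -(reindex_inj (h := s) (F := fun j => (lift i j < i : nat)%N) (P := xpredT)) /=;
    last exact: perm_inj.
  transitivity (\sum_(j < n) (j < i))%N.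
    apply: eq_bigr => j _; rewrite /= /bump.
    by case: (leqP i j) => h; [rewrite add1n ltnNge (leqW h)|rewrite h].
  have lein : (i <= n)%N by rewrite -ltnS.
  transitivity (\sum_(j < n | j < i) 1)%N.
    by rewrite [RHS]big_mkcond; apply: eq_bigr => j _; case: ifP.
  by rewrite -(big_ord_widen n (fun=> 1%N)) // sum1_card card_ord.
apply: eq_bigr => a _; rewrite big_ord_recl ltn0 add0n.
apply: eq_bigr => b _; rewrite !lift_perm_lift; congr (nat_of_bool (_ && _)).
by rewrite /= /bump; case: (leqP i (s a)); case: (leqP i (s b)); lia.
Qed.

(** Exchanging [i] and [i'] in both entries of a pair affects the order only of the pair formed by
    these two neighbours, so ([i], [i']) is the one inversion gained. *)
Lemma inversions_tperm n (i i' : 'I_n) (s : 'S_n) :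
  i' = i.+1 :> nat -> (s i < s i')%N ->
  inversions (tperm i i' * s)%g = (inversions s).+1.
Proof.
move=> ii' si; rewrite /inversions.
pose f (p : 'I_n * 'I_n) := (tperm i i' p.1, tperm i i' p.2).
have fK : involutive f by case=> a b; rewrite /f /= !tpermK.
set A := [set p | _]; set B := [set p | _ & _].
have -> : A = (i, i') |: (f @^-1: B).
  apply/setP=> -[a b]; rewrite !inE /= !permM xpair_eqE.
  have nii' : (i == i') = false by apply/negbTE; rewrite -val_eqE /=; lia.
  have ni'i : (i' == i) = false by rewrite eq_sym.
  case: tpermP => [->|->|/eqP ai /eqP ai']; case: tpermP => [->|->|/eqP bi /eqP bi'];
    rewrite ?nii' ?ni'i ?(negPf bi') ?(negPf ai) ?eqxx ?ltnn /= ?orbF //.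
  all: try by rewrite -!val_eqE /= in bi bi'; congr (_ && _); lia.
  all: try by rewrite -!val_eqE /= in ai ai'; congr (_ && _); lia.
  - by rewrite ii' ltnSn si.
  - by rewrite [(s i' < s i)%N]ltnNge (ltnW si) !andbF.
rewrite cardsU1 inE /f /= inE /= tpermL tpermR ltnNge ii' leqnSn /= add1n; congr _.+1.
by rewrite -(can2_imset_pre B fK fK) card_imset //; exact: can_inj fK.
Qed.

Lemma prod_ord_split (A : pzRingType) n (F : 'I_n -> A) (i i' : 'I_n) :
  i' = i.+1 :> nat ->
  \prod_(a < n) F a =
    (\prod_(a < n | (a < i)%N) F a) * (F i * F i') * \prod_(a < n | (i' < a)%N) F a.
Proof.
(* [F] is continued by 1 to all naturals, so that the ordered product can be cut at [i] and after
   [i']. *)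
move=> ii'; pose G k := oapp F 1 (insub k).
have GE (a : 'I_n) : G a = F a by rewrite /G valK.
have GP (P : pred nat) : \prod_(a < n | P a) F a = \prod_(0 <= k < n | P k) G k.
  by rewrite big_mkord; apply: eq_bigr => a _; rewrite GE.
rewrite (GP (fun k => k < i)%N) (GP (fun k => i' < k)%N) (GP xpredT).
have [ln ln'] := (ltn_ord i, ltn_ord i').
rewrite (big_cat_nat _ (n := i)) ?(ltnW ln) //= -mulrA; congr (_ * _).
  rewrite [RHS](big_cat_nat _ (n := i)) ?(ltnW ln) //=.
  rewrite [X in _ * X]big_nat_cond [X in _ * X]big_pred0 ?mulr1.
    by rewrite big_nat [RHS]big_nat_cond; apply: eq_bigl => k; case: (_ < _)%N; rewrite ?andbF.
  by move=> k; lia.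
rewrite big_ltn // big_ltn -?ii' // !GE mulrA; congr (_ * _).
rewrite [RHS](big_cat_nat _ (n := i'.+1)) //=.
rewrite [X in X * _]big_nat_cond [X in X * _]big_pred0 ?mul1r.
  by rewrite big_nat_cond [RHS]big_nat_cond; apply: eq_bigl => k; lia.
by move=> k; lia.
Qed.

(** * Quantum determinants *)

Section QuantumDeterminant.
Variables (R : realType) (q : R) (N : nat).
Local Notation C := R[i].
Local Notation U := (Uq q N).
Local Notation qC := (real_complex R q : C).
Local Notation u := (@uq_u R q N).

(** The permutations s and (i i') s are paired; their signs differ by a factor - q. This isolates
    the 2 x 2 quantum minors of the rows [i], [i'], on which a row exchange can be studied. *)
Lemma qdet_adjacent n (M : 'I_n -> 'I_n -> U) (i i' : 'I_n) : i' = i.+1 :> nat ->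
  qdet M = \sum_(s : 'S_n | (s i < s i')%N) (- qC) ^+ inversions s *:
    ((\prod_(a < n | (a < i)%N) M a (s a)) *
     (M i (s i) * M i' (s i') - qC *: (M i (s i') * M i' (s i))) *
     \prod_(a < n | (i' < a)%N) M a (s a)).
Proof.
move=> ii'; rewrite /qdet (bigID (fun s : 'S_n => (s i < s i')%N)) /=.
rewrite [X in _ + X](reindex_inj (mulgI (tperm i i'))) /=.
rewrite [X in _ + X](eq_bigl (fun s : 'S_n => (s i < s i')%N)); last first.
  move=> s; rewrite !permM tpermL tpermR -leqNgt leq_eqVlt val_eqE.
  by rewrite (inj_eq perm_inj) -val_eqE /= ii' ltn_eqF.
rewrite -big_split /=; apply: eq_bigr => s si.
rewrite (inversions_tperm ii' si) exprS !(prod_ord_split _ ii') !permM tpermL tpermR.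
rewrite [- qC * _]mulrC -[X in _ + X]scalerA -scalerDr; congr (_ *: _).
have tE (a : 'I_n) : (a < i)%N || (i' < a)%N -> tperm i i' a = a.
  by move=> h; rewrite tpermD //; apply/eqP => /(congr1 val) /=; lia.
rewrite [X in _ + _ *: (X * _ * _)](eq_bigr (fun a => M a (s a))); last first.
  by move=> a ai; rewrite permM tE ?ai.
rewrite [X in _ + _ *: (_ * _ * X)](eq_bigr (fun a => M a (s a))); last first.
  by move=> a ai; rewrite permM tE ?ai ?orbT.
by rewrite mulrBr mulrBl scaleNr scalerAl scalerAr.
Qed.

Lemma qdet_swap n (M M' : 'I_n -> 'I_n -> U) (i i' : 'I_n) : i' = i.+1 :> nat ->
  (forall a, a != i -> a != i' -> M' a =1 M a) ->
  (forall j l : 'I_n, (j < l)%N ->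
    M' i j * M' i' l - qC *: (M' i l * M' i' j) =
    - qC *: (M i j * M i' l - qC *: (M i l * M i' j))) ->
  qdet M' = - qC *: qdet M.
Proof.
move=> ii' MM swap; rewrite !(qdet_adjacent _ ii') scaler_sumr.
apply: eq_bigr => s si; rewrite swap // [RHS]scalerA [- qC * _]mulrC -[RHS]scalerA.
rewrite -[in LHS]scalerAr -[in LHS]scalerAl; congr (_ *: (_ *: (_ * _ * _)));
  by apply: eq_bigr => a ai; apply: MM; rewrite -val_eqE /=; lia.
Qed.

Lemma uq_relE x y : uq_rel q (N:=N) x y -> cls (uq_rel q (N:=N)) x = cls (uq_rel q (N:=N)) y.
Proof. by move=> xy; apply/clsP/pres_rel. Qed.

Lemma uq_colE (i j k : 'I_N) : (i < k)%N -> u i j * u k j = qC *: (u k j * u i j).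
Proof.
move=> ik; have := uq_relE (uq_col q j ik).
by rewrite !clsM clsC -presented_scaleAl mul1r.
Qed.

Lemma uq_rowE (i j l : 'I_N) : (j < l)%N -> u i j * u i l = qC *: (u i l * u i j).
Proof.
move=> jl; have := uq_relE (uq_row q i jl).
by rewrite !clsM clsC -presented_scaleAl mul1r.
Qed.

Lemma uq_commE (i j k l : 'I_N) : (i < k)%N -> (l < j)%N -> u i j * u k l = u k l * u i j.
Proof. by move=> ik lj; have := uq_relE (uq_comm q ik lj); rewrite !clsM. Qed.

Lemma uq_crossE (i j k l : 'I_N) : (i < k)%N -> (j < l)%N ->
  u i j * u k l = u k l * u i j - (qC^-1 - qC) *: (u i l * u k j).
Proof.
move=> ik jl; have := uq_relE (uq_cross q ik jl).
by rewrite clsD !clsM clsC -presented_scaleAl mul1r scaleNr.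
Qed.

Lemma uq_detVl : uq_detV q N * uq_det q N = 1.
Proof. by have := uq_relE (Defs.uq_detVl q N); rewrite clsM -uq_detE clsC scale1r. Qed.

Lemma uq_detVr : uq_det q N * uq_detV q N = 1.
Proof. by have := uq_relE (Defs.uq_detVr q N); rewrite clsM -uq_detE clsC scale1r. Qed.

Hypothesis q_neq0 : q != 0.

Lemma qC_neq0 : qC != 0.
Proof. by rewrite fmorph_eq0. Qed.

(** The cross relation rewrites u_bl u_aj as u_aj u_bl + (q^-1 - q) u_al u_bj; the coefficient of
    u_al u_bj becomes 1 - q (q^-1 - q) = q^2. *)
Lemma uq_swap (a b j l : 'I_N) : (a < b)%N -> (j < l)%N ->
  u b j * u a l - qC *: (u b l * u a j) = - qC *: (u a j * u b l - qC *: (u a l * u b j)).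
Proof.
move=> ab jl; rewrite -[u b j * _](uq_commE ab jl).
have -> : u b l * u a j = u a j * u b l + (qC^-1 - qC) *: (u a l * u b j).
  by rewrite (uq_crossE ab jl) subrK.
rewrite scalerDr scalerBr !scalerA mulrBr divff ?qC_neq0 // scalerBl scale1r.
by rewrite mulNr !scaleNr opprK opprD addrCA opprB [X in _ + X]addrCA subrr addr0.
Qed.
End QuantumDeterminant.

(** * Laplace expansion and the row relation *)

Lemma reindex_lift_perm (V : nmodType) n (F : 'S_n.+1 -> V) :
  \sum_(s : 'S_n.+1) F s = \sum_(k < n.+1) \sum_(t : 'S_n) F (lift_perm ord0 k t).
Proof.
rewrite (partition_big (fun s : 'S_n.+1 => s ord0) xpredT) //=.
apply: eq_bigr => k _; rewrite (reindex (lift_perm ord0 k)).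
  by apply: eq_bigl => t; rewrite lift_perm_id eqxx.
have down (s : 'S_n.+1) : exists t : 'S_n, s = lift_perm ord0 (s ord0) t.
  have liftE j : {j' | s (lift ord0 j) = lift (s ord0) j'}.
    have := neq_lift ord0 j; rewrite -(inj_eq (@perm_inj _ s)) => /unlift_some[j' h _].
    by exists j'.
  have inj : injective (fun j => sval (liftE j)).
    move=> i j; case: (liftE i) (liftE j) => /= i' hi [/= j' hj] ij.
    by apply: (@lift_inj _ ord0); apply: (@perm_inj _ s); rewrite hi hj ij.
  exists (perm inj); apply/permP => j; have [j'|] := unliftP ord0 j => ->.
    by rewrite lift_perm_lift permE; case: (liftE j').
  by rewrite lift_perm_id.
exists (fun s => sval (cid (down s))) => [t _|s /eqP s0].
  case: cid => t' /= /permP h; apply/permP => j.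
  by have := h (lift ord0 j); rewrite lift_perm_id !lift_perm_lift => /lift_inj.
by case: cid => t' /= st; rewrite [RHS]st s0.
Qed.

Section Laplace.
Variables (R : realType) (q : R) (n : nat).
Hypothesis q_neq0 : q != 0.
Local Notation N := n.+1.
Local Notation U := (Uq q N).
Local Notation qC := (real_complex R q : R[i]).
Local Notation u := (@uq_u R q N).

Lemma qdet_first_row (M : 'I_N -> 'I_N -> U) :
  qdet M = \sum_(k < N) (- qC) ^+ k *:
     (M ord0 k * qdet (fun a b : 'I_n => M (lift ord0 a) (lift k b))).
Proof.
rewrite /qdet reindex_lift_perm; apply: eq_bigr => k _.
rewrite mulr_sumr scaler_sumr; apply: eq_bigr => t _.
rewrite inversions_lift0 exprD big_ord_recl lift_perm_id -scalerA scalerAr.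
by congr (_ *: (_ * (_ *: _))); apply: eq_bigr => a _; rewrite lift_perm_lift.
Qed.

(* For p <= k, the i-th term of 0, .., N-1 with k moved to position p. *)
Definition moved_row (k p i : 'I_N) : 'I_N :=
  if (i < p)%N || (k < i)%N then i else if i == p then k
  else Ordinal (leq_ltn_trans (leq_pred i) (ltn_ord i)).

(** Row [k] travels up one position at a time: the matrices for p and p + 1 differ by an exchange of
    the adjacent rows p and p + 1, and each exchange costs a factor - q. *)
Lemma qdet_moved_row (k p : 'I_N) : (p <= k)%N ->
  qdet (fun i j => u (moved_row k p i) j) = (- qC) ^+ (k - p) *: uq_det q N.
Proof.
move=> pk; have [d dE] : exists d, (k - p)%N = d by exists (k - p)%N.
elim: d p pk dE => [|d IH] p pk dE.
  rewrite dE expr0 scale1r; congr qdet; apply/funext => i; apply/funext => j.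
  congr (u _ j); rewrite /moved_row; have {dE} -> : p = k by apply/val_inj => /=; lia.
  case: ifP => // ik; case: eqP => // /eqP; rewrite -val_eqE /= => h; lia.
have p1 : (p.+1 < N)%N by have := ltn_ord k; lia.
rewrite dE exprS -scalerA -(_ : (k - p.+1)%N = d); last lia.
rewrite -(IH (Ordinal p1)) /=; [|lia|lia].
apply: (@qdet_swap _ _ _ _ _ _ p (Ordinal p1)) => //= [a ap ap1 j|j l jl].
  rewrite -!val_eqE /= in ap ap1; congr (u _ j); rewrite /moved_row /= -!val_eqE /=.
  by rewrite (negPf ap) (negPf ap1); do 2!case: ifP => //; lia.
have pk' : (p < k)%N by lia.
have E1 : moved_row k p p = k.
  by rewrite /moved_row ltnn eqxx ltnNge ltnW.
have E2 : moved_row k p (Ordinal p1) = p.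
  apply/val_inj; rewrite /moved_row /= -val_eqE /=.
  by rewrite (negPf (_ : ~~ ((p.+1 < p)%N || (k < p.+1)%N))) ?(gtn_eqF (ltnSn p)) /=; lia.
have E3 : moved_row k (Ordinal p1) p = p.
  by rewrite /moved_row /= ltnSn.
have E4 : moved_row k (Ordinal p1) (Ordinal p1) = k.
  by apply/val_inj; rewrite /moved_row /= -val_eqE /=; case: ifP; [lia|case: ifP; lia].
by rewrite E1 E2 E3 E4; exact: uq_swap.
Qed.

(** Once row [k] is at the top, the other rows follow in their natural order, so the expansion along
    the first row produces the minors that enter the involution. *)
Lemma uq_laplace (k : 'I_N) :
  \sum_(s < N) (- qC) ^+ s *: (u k s * uq_minor q k s) = (- qC) ^+ k *: uq_det q N.
Proof.
have := @qdet_moved_row k ord0 (leq0n k); rewrite subn0 => <-; rewrite qdet_first_row.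
apply: eq_bigr => s _; congr (_ *: (u _ _ * qdet _)).
apply/funext => a; apply/funext => b; congr u; apply/val_inj.
by rewrite /moved_row /=; case: ifP => /=; rewrite /bump; lia.
Qed.

(** By [star_u], the sum is the Laplace expansion along row [k], divided by (-q)^k and multiplied by
    D^-1 from the right. *)
Lemma uq_row_unitary (st : uq_star q N) (k : 'I_N) : \sum_(s < N) u k s * st (u k s) = 1.
Proof.
have q0 : - qC != 0 by rewrite oppr_eq0 qC_neq0.
transitivity (((- qC) ^- k * (- qC) ^+ k) *: (uq_det q N * uq_detV q N)); last first.
  by rewrite mulVf ?expf_neq0 // scale1r uq_detVr.
rewrite -scalerA scalerAl -uq_laplace mulr_suml scaler_sumr; apply: eq_bigr => s _.
rewrite star_u -scalerAr -scalerAl mulrA scalerA; congr (_ *: _).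
by rewrite expfzDr // mulrC -exprnP exprnN.
Qed.
End Laplace.

(** * Linear maps, induction on U_q(N) and algebra maps *)

Lemma exists_scalar (K : pzRingType) (V : lmodType K) (f : V -> K) :
  scalar f -> exists g : {scalar V}, g =1 f.
Proof.
move=> lf; pose Lf := GRing.isLinear.Build K V K *%R f lf.
by pose g : {scalar V} := HB.pack f Lf; exists g.
Qed.

Lemma exists_linear (K : pzRingType) (V W : lmodType K) (f : V -> W) :
  linear f -> exists g : {linear V -> W}, g =1 f.
Proof.
move=> lf; pose Lf := GRing.isLinear.Build K V W *:%R f lf.
by pose g : {linear V -> W} := HB.pack f Lf; exists g.
Qed.

Section Generation.
Variables (R : realType) (q : R) (N : nat).
Local Notation C := R[i].
Local Notation U := (Uq q N).
Local Notation u := (@uq_u R q N).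

(** D is a polynomial in the u_ij, so the case of D^-1 may assume the property for D. Properties of
    cocycles and limits pass to D^-1 in this way. *)
Lemma uq_ind (P : U -> Prop) :
  (forall c : C, P (c *: 1)) -> (forall a b, P a -> P b -> P (a + b)) ->
  (forall a b, P a -> P b -> P (a * b)) -> (forall i j, P (u i j)) ->
  (P (uq_det q N) -> P (uq_detV q N)) -> forall a, P a.
Proof.
move=> PZ PD PM Pu PV a; have [x ->] := cls_surj a.
elim: x => [c|[i j|]|x Px y Py|x Px y Py]; rewrite ?clsD ?clsM ?clsC; auto.
  exact: Pu.
have P0 : P 0 by rewrite -(scale0r 1); exact: PZ.
have P1 : P 1 by rewrite -(scale1r 1); exact: PZ.
apply: PV; apply: (big_ind P P0 PD) => s _; rewrite -mulr_algl; apply: (PM); first exact: PZ.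
by apply: (big_ind P P1 PM) => i _; exact: Pu.
Qed.

Section Lift.
Variables (A : algType C) (f : uq_gen N -> A).
Hypothesis f_rel : forall x y, uq_rel q (N:=N) x y -> evalt f x = evalt f y.
Local Notation F := (@pres_lift _ _ _ f (uq_rel q (N:=N)) : U -> A).

Lemma pres_liftM a b : F (a * b) = F a * F b.
Proof.
have [[x ->] [y ->]] := (cls_surj a, cls_surj b).
by rewrite -clsM !(pres_liftE f_rel).
Qed.

Lemma pres_liftD a b : F (a + b) = F a + F b.
Proof.
have [[x ->] [y ->]] := (cls_surj a, cls_surj b).
by rewrite -clsD !(pres_liftE f_rel).
Qed.

Lemma pres_lift1 c : F (c *: 1) = c%:A.
Proof. by rewrite -[_ *: 1](clsC (uq_rel q (N:=N))) (pres_liftE f_rel). Qed.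
End Lift.

(** For a diagonal matrix with commuting entries only the identity permutation contributes to D, and
    the extra term u_il u_kj of the cross relation vanishes: i = l and k = j would contradict i < k
    and j < l. *)
Lemma uq_diag_rel (A : algType C) (t : 'I_N -> A) (s : A) :
  (forall i j, t i * t j = t j * t i) ->
  s * \prod_(i < N) t i = 1 -> \prod_(i < N) t i * s = 1 ->
  let f (g : uq_gen N) := if g is UGen i j then (i == j)%:R *: t i else s in
  forall x y, uq_rel q (N:=N) x y -> evalt f x = evalt f y.
Proof.
move=> tC st ts f x y.
have delta (a b c d : 'I_N) : (a == b -> c == d -> False) ->
    ((a == b)%:R *: t a) * ((c == d)%:R *: t c) = 0.
  move=> F; have [ab|_] := a =P b; last by rewrite scale0r mul0r.
  by have [cd|_] := c =P d; [case: F; apply/eqP | rewrite scale0r mulr0].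
have det : evalt f (uq_det_term q N) = \prod_(i < N) t i.
  rewrite /uq_det_term (big_morph (evalt f) (id1 := 0) (op1 := +%R)) //;
    last by rewrite /= scale0r.
  have prodE (p : 'S_N) : evalt f (\big[Mul/Cst 1]_(i < N) Gen (UGen i (p i))) =
      (\prod_(i < N) (i == p i)%:R) *: \prod_(i < N) t i.
    by rewrite -scaler_prod; apply: (big_morph (evalt f)) => //=; rewrite scale1r.
  have delta1 : \prod_(i < N) (i == (1%g : 'S_N) i)%:R = 1 :> C.
    by rewrite big1 // => i _; rewrite perm1 eqxx.
  rewrite (bigD1 (1%g : 'S_N)) //= prodE delta1 inversions1 expr0 !scale1r mul1r.
  rewrite [X in _ + X]big1 ?addr0 // => p p1 /=; rewrite prodE.
  have [i pi] : exists i, p i != i.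
    apply/existsP; apply: contraNT p1 => /existsPn p1.
    by apply/eqP/permP => i; rewrite perm1; apply/eqP; rewrite -[_ == _]negbK p1.
  by rewrite (bigD1 i) //= eq_sym (negPf pi) mul0r scale0r mulr0.
case=> {x y} [i j k ik|i j l jl|i j k l ik lj|i j k l ik jl| |]; rewrite /= ?det ?scale1r //.
- rewrite !delta ?mulr0 // => /eqP E /eqP F; move: ik; rewrite ?E ?F ltnn //.
- rewrite !delta ?mulr0 // => /eqP E /eqP F; move: jl; rewrite -?E -?F ltnn //.
- by rewrite -!scalerAl -!scalerAr !scalerA tC mulrC.
- rewrite [X in _ + _ * X]delta ?mulr0 ?addr0.
    by rewrite -!scalerAl -!scalerAr !scalerA tC mulrC.
  by move=> /eqP E /eqP F; move: ik; rewrite E F => /ltn_trans /(_ jl); rewrite ltnn.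
Qed.

End Generation.

Lemma truncated_mul (K : comNzRingType) (A : algType K) (x : A) (e d c e' d' c' : K) :
  x * (x * x) = 0 ->
  (e *: 1 + d *: x + c *: (x * x)) * (e' *: 1 + d' *: x + c' *: (x * x)) =
  (e * e') *: 1 + (e * d' + d * e') *: x + (e * c' + d * d' + c * e') *: (x * x).
Proof.
move=> x3; have x4 : x * x * x = 0 by rewrite -mulrA.
have x5 : (x * x) * (x * x) = 0 by rewrite mulrA x4 mul0r.
rewrite !mulrDl !mulrDr -!scalerAl -!scalerAr !mulr1 !mul1r x3 x4 x5.
rewrite !scaler0 !addr0 !scalerDl !scalerA -!addrA; congr (_ + _).
by congr (_ + _); rewrite addrCA.
Qed.

(** * Derivations and second order terms from truncated polynomials *)

Section Jets.
Variables (R : realType) (q : R) (N : nat).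
Local Notation C := R[i].
Local Notation U := (Uq q N).
Local Notation u := (@uq_u R q N).
Local Notation eps := (@uq_counit R q N).

Let J : 'M[C]_3 := \matrix_(i, j) (j == i.+1 :> nat)%:R.
Let J2 : 'M[C]_3 := \matrix_(i, j) (j == i.+2 :> nat)%:R.

(** The element e + d J + c J^2 of C[J]/(J^3), realised by matrices so that its coefficients form
    the first row. *)
Let toep (e d c : C) : 'M[C]_3 := e *: 1 + d *: J + c *: J2.

Let toepE e d c : [/\ toep e d c 0 0 = e, toep e d c 0 1 = d & toep e d c 0 ord_max = c].
Proof.
by split; rewrite !mxE /= ?mulr1 ?mulr0 ?addr0 ?add0r.
Qed.

Let toepM e d c e' d' c' :
  toep e d c * toep e' d' c' = toep (e * e') (e * d' + d * e') (e * c' + d * d' + c * e').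
Proof.
have JJ : J * J = J2.
  by apply/matrixP => -[[|[|[|i]]] // hi] [[|[|[|j]]] // hj];
    rewrite !mxE !big_ord_recl big_ord0 !mxE /= ?mulr0 ?mul0r ?mulr1 ?addr0 ?add0r.
have JJ2 : J * J2 = 0.
  by apply/matrixP => -[[|[|[|i]]] // hi] [[|[|[|j]]] // hj];
    rewrite !mxE !big_ord_recl big_ord0 !mxE /= ?mulr0 ?mul0r ?mulr1 ?addr0 ?add0r.
have J2J : J2 * J = 0 by rewrite -JJ -mulrA JJ JJ2.
by rewrite /toep -JJ; apply: truncated_mul; rewrite JJ.
Qed.

Let toepD e d c e' d' c' : toep e d c + toep e' d' c' = toep (e + e') (d + d') (c + c').
Proof. by rewrite /toep !scalerDl addrACA [X in X + _ = _]addrACA. Qed.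

Let toepZ k e d c : k *: toep e d c = toep (k * e) (k * d) (k * c).
Proof. by rewrite /toep !scalerDr !scalerA. Qed.

Let toep_scal k A : toep k 0 0 * A = k *: A.
Proof. by rewrite /toep !scale0r !addr0 mulr_algl. Qed.

Let toep1 : toep 1 0 0 = 1.
Proof. by rewrite /toep !scale0r !addr0 scale1r. Qed.

(* [d a] and [c a] are the coefficients of J and J^2 in the image of [a] under
   the algebra map u_jk |-> delta_jk (1 + delta_jm J), where J^3 = 0. *)
Lemma uq_jets (m : 'I_N) : exists d c : {scalar U},
  [/\ forall a b, d (a * b) = eps a * d b + d a * eps b,
      forall a b, c (a * b) = eps a * c b + d a * d b + c a * eps b,
      forall i j, d (u i j) = ((i == j) && (i == m))%:R &
      d (uq_detV q N) = -1].
Proof.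
move: toepE toepM toepD toepZ toep_scal toep1.
move: (toep) => T TE TM TD TZ Tscal T1.
(* [s] is 1 - J + J^2, the inverse of the image 1 + J of D. *)
pose t i := T 1 (i == m)%:R 0; pose s := T 1 (-1) 1.
have prodt : \prod_(i < N) t i = T 1 1 0.
  transitivity (\prod_(i < N | i == m) T 1 1 0); last by rewrite big_pred1_eq.
  rewrite [RHS]big_mkcond.
  by apply: eq_bigr => i _; rewrite /t; case: eqP => // _; exact: T1.
have tC i j : t i * t j = t j * t i by rewrite !TM; congr T; ring.
have st : s * \prod_(i < N) t i = 1 by rewrite prodt TM -T1; congr T; ring.
have ts : \prod_(i < N) t i * s = 1 by rewrite prodt TM -T1; congr T; ring.
have := @uq_diag_rel R q N 'M[C]_3 t s tC st ts; set f := (f in let f := f in _) => /= rel.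
pose F : U -> 'M[C]_3 := @pres_lift _ _ _ f (uq_rel q (N:=N)).
have FM a b : F (a * b) = F a * F b by exact: (pres_liftM rel).
have FD a b : F (a + b) = F a + F b by exact: (pres_liftD rel).
have F1 c : F (c *: 1) = T c 0 0.
  by rewrite [LHS](pres_lift1 rel) -T1 TZ !mulr0 mulr1.
have Fu i j : F (u i j) = T (i == j)%:R ((i == j) && (i == m))%:R 0.
  rewrite [LHS](pres_liftE rel) /= /t TZ mulr1 mulr0; congr T.
  by rewrite -mulnb natrM.
have FV : F (uq_detV q N) = s by rewrite [LHS](pres_liftE rel).
(* The image consists of truncated polynomials whose constant term is the counit. *)
have FE : forall a, exists d c, F a = T (eps a) d c.
  apply: uq_ind => [k|a b [d [c E]] [d' [c' E']]|a b [d [c E]] [d' [c' E']]|i j|_].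
  - by exists 0, 0; rewrite F1 linearZ /= rmorph1 mulr1.
  - by rewrite FD E E' TD raddfD; do 2!eexists.
  - by rewrite FM E E' TM rmorphM; do 2!eexists.
  - by rewrite Fu uq_counit_u; do 2!eexists.
  - by rewrite FV uq_counit_detV; do 2!eexists.
have FZ k a : F (k *: a) = k *: F a by rewrite -mulr_algl FM F1 Tscal.
have FT a : F a = T (eps a) (F a 0 1) (F a 0 ord_max).
  have [d [c E]] := FE a; have [_ hd hc] := TE (eps a) d c.
  by rewrite E hd hc.
have [d dE] : exists d : {scalar U}, d =1 (fun a => F a 0 1).
  by apply: exists_scalar => k a b; rewrite FD FZ !mxE.
have [c cE] : exists c : {scalar U}, c =1 (fun a => F a 0 ord_max).
  by apply: exists_scalar => k a b; rewrite FD FZ !mxE.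
exists d, c; split=> [a b|a b|i j|].
- have [_ h _] := TE (eps a * eps b) (eps a * F b 0 1 + F a 0 1 * eps b)
    (eps a * F b 0 ord_max + F a 0 1 * F b 0 1 + F a 0 ord_max * eps b).
  by rewrite !dE FM {1}(FT a) {1}(FT b) TM h.
- have [_ _ h] := TE (eps a * eps b) (eps a * F b 0 1 + F a 0 1 * eps b)
    (eps a * F b 0 ord_max + F a 0 1 * F b 0 1 + F a 0 ord_max * eps b).
  by rewrite !dE !cE FM {1}(FT a) {1}(FT b) TM h.
- have [_ h _] := TE (i == j)%:R ((i == j) && (i == m))%:R 0.
  by rewrite dE Fu h.
- by have [_ h _] := TE 1 (-1) 1; rewrite dE FV h.
Qed.
End Jets.

(** * The counit and the involution *)

Section CounitStar.
Variables (R : realType) (q : R) (N : nat).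
Hypotheses (q_gt0 : 0 < q) (q_lt1 : q < 1).
Variable st : uq_star q N.
Local Notation C := R[i].
Local Notation qC := (real_complex R q : C).
Local Notation u := (@uq_u R q N).
Local Notation eps := (@uq_counit R q N).

(** Here k is the larger of the two indices, so that u_kk lies in the row or the column of u_ij. As
    u_kk has counit 1 and q < 1, this relation later determines the behaviour of u_ij from that of
    u_kk. *)
Lemma uq_offdiag (i j : 'I_N) : i != j -> exists k : 'I_N,
  [/\ (i <= k)%N, (j <= k)%N, (k == i) || (k == j) &
      u i j * u k k = qC *: (u k k * u i j)].
Proof.
rewrite neq_lt => /orP[ij|ji].
  by exists j; split; rewrite ?eqxx ?orbT // ?(ltnW ij) //; exact: uq_colE.
by exists i; split; rewrite ?eqxx ?orbT // ?(ltnW ji) //; exact: uq_rowE.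
Qed.

Lemma uq_star_row (k : 'I_N) : \sum_(s < N) u k s * st (u k s) = 1.
Proof.
have q0 : q != 0 by rewrite gt_eqF.
by case: N st k => [|n] s k; [case: k|exact: uq_row_unitary].
Qed.

Lemma conj_qC : (qC^* = qC)%R.
Proof. by apply: CrealP; rewrite complex_real. Qed.

Lemma one_sub_qC_neq0 : 1 - qC != 0.
Proof. by rewrite -(rmorph1 (real_complex R)) -rmorphB fmorph_eq0 subr_eq0 gt_eqF. Qed.

Lemma star1 : st 1 = 1.
Proof. by rewrite -[LHS]mulr1 -{2}[1](starK st) -starM mulr1 starK. Qed.

Lemma counit_det1 : eps (uq_det q N) = 1.
Proof. by have := congr1 eps (uq_detVr q N); rewrite rmorphM rmorph1 /= uq_counit_detV mulr1. Qed.

(** On the diagonal the counit of the row relation leaves a single term. Off the diagonal, the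
    counit of the adjoint of the q-commutation with u_kk yields x = q x. *)
Lemma counit_star_u i j : eps (st (u i j)) = (i == j)%:R.
Proof.
have diag k : eps (st (u k k)) = 1.
  have := congr1 eps (uq_star_row k); rewrite rmorph1 rmorph_sum /= (bigD1 k) //=.
  rewrite rmorphM /= uq_counit_u eqxx mul1r big1 ?addr0 // => s sk.
  by rewrite rmorphM /= uq_counit_u eq_sym (negPf sk) mul0r.
have [->|ij] := eqVneq i j; first exact: diag.
have [k [_ _ _ /(congr1 (eps \o st))]] := uq_offdiag ij.
rewrite /= starM starZ starM linearZ /= !rmorphM /= diag mulr1 mul1r conj_qC.
move/eqP; rewrite -subr_eq0 -{1}[eps _]mul1r -mulrBl mulf_eq0 (negPf one_sub_qC_neq0).
by move/eqP.
Qed.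

Lemma counit_star a : eps (st a) = ((eps a)^*)%R.
Proof.
elim/uq_ind: a => [c|a b Ea Eb|a b Ea Eb|i j|_].
- by rewrite starZ star1 !linearZ /= rmorph1 !mulr1.
- by rewrite starD !raddfD /= Ea Eb.
- by rewrite starM !rmorphM /= Ea Eb mulrC.
- by rewrite counit_star_u uq_counit_u rmorph_nat.
- by rewrite star_detV counit_det1 uq_counit_detV rmorph1.
Qed.
End CounitStar.

(** * Hilbert spaces *)

Section HilbertFacts.
Variables (R : realType) (H : hilbert R).
Local Notation C := R[i].

Lemma innerDl (x y z : H) : inner H (x + y) z = inner H x z + inner H y z.
Proof. by rewrite innerC innerDr rmorphD /= -!innerC. Qed.
Lemma innerBl (x y z : H) : inner H (x - y) z = inner H x z - inner H y z.
Proof. by rewrite innerC innerBr rmorphB /= -!innerC. Qed.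
Lemma innerZl c (x y : H) : inner H (c *: x) y = (c^*)%R * inner H x y.
Proof. by rewrite innerC innerZr rmorphM /= -innerC. Qed.
Lemma inner0l (x : H) : inner H 0 x = 0.
Proof. by rewrite innerC inner0r rmorph0. Qed.
Lemma hnorm_sqr (x : H) : hnorm x ^+ 2 = inner H x x.
Proof. exact: sqrtCK. Qed.
Lemma hnorm0 : hnorm (0 : H) = 0.
Proof. by apply/eqP; rewrite -sqrf_eq0 hnorm_sqr inner0r. Qed.

Lemma hnorm_triangle (x y : H) : hnorm (x + y) <= hnorm x + hnorm y.
Proof.
rewrite -(ler_pXn2r (n := 2)) ?nnegrE ?addr_ge0 ?hnorm_ge0 //.
rewrite sqrrD !hnorm_sqr innerDl !innerDr -!addrA lerD2l !addrA lerD2r.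
have : inner H x y + inner H y x \is Num.real.
  by apply/CrealP; rewrite rmorphD /= -!innerC addrC.
move=> /real_ler_norm/le_trans -> //; apply: le_trans (ler_normD _ _) _.
by rewrite [inner H y x]innerC norm_conjC lerD ?cauchy_schwarz.
Qed.

Lemma hnormZ c (x : H) : hnorm (c *: x) = `|c| * hnorm x.
Proof.
apply: (pexpIrn (n := 2)); rewrite ?nnegrE ?mulr_ge0 ?hnorm_ge0 //.
by rewrite exprMn !hnorm_sqr innerZl innerZr mulrA -normCKC.
Qed.

Lemma hnorm_subC (x y : H) : hnorm (x - y) = hnorm (y - x).
Proof. by rewrite -hnorm_opp opprB. Qed.

Lemma inner_eq0 (x : H) : inner H x x = 0 -> x = 0.
Proof. by move=> xx; apply: hnorm_eq0; apply/eqP; rewrite -sqrf_eq0 hnorm_sqr xx. Qed.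

Lemma hcvg_cst (x : H) : hcvg (fun=> x) x.
Proof. by move=> e e0; exists 0%N => n _; rewrite subrr [dot_norm _ _]hnorm0. Qed.

Lemma hcvgD (x y : nat -> H) l m : hcvg x l -> hcvg y m -> hcvg (fun n => x n + y n) (l + m).
Proof.
move=> xl ym e e0; have e2 : 0 < e / 2 by rewrite divr_gt0.
have [[n1 h1] [n2 h2]] := (xl _ e2, ym _ e2).
exists (maxn n1 n2) => n; rewrite geq_max => /andP[/h1 h /h2 h'].
rewrite opprD addrACA; apply: le_lt_trans (hnorm_triangle _ _) _.
by rewrite [e]splitr ltrD.
Qed.

Lemma hcvg_bounded (K : hilbert R) (f : H -> K) (M : C) x l :
  {morph f : a b / a - b} -> 0 <= M ->
  (forall a, hnorm (f a) <= M * hnorm a) -> hcvg x l -> hcvg (fun n => f (x n)) (f l).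
Proof.
move=> fB M0 fM xl e e0; have M1 : 0 < M + 1 by rewrite ltr_wpDl.
have [n0 h] := xl (e / (M + 1)) (divr_gt0 e0 M1).
exists n0 => n /h; rewrite ltr_pdivlMr // => hn; rewrite -fB.
apply: le_lt_trans (fM _) (le_lt_trans _ hn).
by rewrite mulrC ler_wpM2l ?hnorm_ge0 // lerDl.
Qed.

Lemma hcvgZ c (x : nat -> H) l : hcvg x l -> hcvg (fun n => c *: x n) (c *: l).
Proof.
move=> xl; apply: (@hcvg_bounded H _ `|c| _ _ _ _ _ xl) => //.
  by move=> a b; rewrite scalerBr.
by move=> a; rewrite hnormZ.
Qed.

Lemma hcvgB (x y : nat -> H) l m : hcvg x l -> hcvg y m -> hcvg (fun n => x n - y n) (l - m).
Proof.
move=> xl /(hcvgZ (-1)) ym; rewrite -scaleN1r.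
by have := hcvgD xl ym; congr hcvg; apply/funext => n; rewrite scaleN1r.
Qed.

Lemma hcvg_unique (x : nat -> H) l m : hcvg x l -> hcvg x m -> l = m.
Proof.
move=> xl xm; apply/eqP; rewrite -subr_eq0; apply: contraT => lm.
have h : 0 < hnorm (l - m) by rewrite lt_def hnorm_ge0 andbT; apply: contra lm => /eqP/hnorm_eq0->.
have [n0 hn] := hcvgB xl xm h.
by have := hn _ (leqnn _); rewrite subrr sub0r [dot_norm _ _]hnorm_opp ltxx.
Qed.
End HilbertFacts.

(** * The complex numbers as a Hilbert space *)

Section ScalarHilbert.
Variable R : realType.
Local Notation C := R[i].

(** The second argument is conjugated because [hdot] is linear in its first. *)
Definition cdot (x y : C^o) : C := x * (y^*)%R.

Fact cdot_bilinear : bilinear_for ( *%R : GRing.Scale.law C C)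
  (Num.Def.conjC \; *%R : GRing.Scale.law C C) cdot.
Proof.
split=> [x|x] c y z; rewrite /cdot /=; first by rewrite mulrDl mulrA.
by rewrite rmorphD /= rmorphM /= mulrDr mulrCA.
Qed.
HB.instance Definition _ := bilinear_isBilinear.Build C C^o C^o C
  ( *%R : GRing.Scale.law C C) (Num.Def.conjC \; *%R) cdot cdot_bilinear.

Fact cdot_hermitian x y : cdot x y = (-1) ^+ false * Num.Def.conjC (cdot y x).
Proof. by rewrite expr0 mul1r /cdot rmorphM /= conjCK mulrC. Qed.
HB.instance Definition _ := isHermitianSesquilinear.Build C C^o false
  Num.Def.conjC cdot cdot_hermitian.

Fact cdot_gt0 x : x != 0 -> 0 < cdot x x.
Proof. by move=> x0; rewrite /cdot -normCK exprn_gt0 // normr_gt0. Qed.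
HB.instance Definition _ := isDotProduct.Build C C^o cdot cdot_gt0.

Lemma cdot_norm x : dot_norm cdot x = `|x|.
Proof. by rewrite /dot_norm /= /cdot -normCK sqrCK. Qed.

Lemma cauchy_seq_cvg (r : nat -> R) :
  (forall e, 0 < e -> exists n0, forall m n, (n0 <= m)%N -> (n0 <= n)%N -> `|r m - r n| < e) ->
  exists l, forall e, 0 < e -> exists n0, forall n, (n0 <= n)%N -> `|r n - l| < e.
Proof.
(* The limit will be the supremum of the eventual lower bounds of the sequence. *)
move=> rC; pose A := [set x | exists n0, forall n, (n0 <= n)%N -> x <= r n]%classic.
have A_ub n0 e : (forall n, (n0 <= n)%N -> `|r n0 - r n| < e) -> ubound A (r n0 + e).
  move=> h x [n1 /(_ (maxn n0 n1) (leq_maxr _ _)) hx].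
  by have := h (maxn n0 n1) (leq_maxl _ _); rewrite ltr_norml => /andP[]; lra.
have A_mem n0 e : (forall n, (n0 <= n)%N -> `|r n0 - r n| < e) -> A (r n0 - e).
  by move=> h; exists n0 => n /h; rewrite ltr_norml => /andP[]; lra.
exists (sup A) => e e0; have e2 : 0 < e / 2 by lra.
have [n0 h] := rC _ e2; exists n0 => n n0n.
have hn m : (n <= m)%N -> `|r n - r m| < e / 2 by move=> nm; apply: h => //; lia.
have A0 : (A !=set0)%classic by exists (r n - e / 2); exact: A_mem.
have h1 : sup A <= r n + e / 2 by apply: ge_sup => //; exact: A_ub.
have h2 : r n - e / 2 <= sup A.
  by apply: ub_le_sup; [exists (r n + e / 2); exact: A_ub|exact: A_mem].
by rewrite ltr_norml; apply/andP; split; lra.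
Qed.

Fact cdot_complete (x : nat -> C^o) : dot_cauchy cdot x -> exists l, dot_cvg cdot x l.
Proof.
move=> xC.
have normci : `|'i%C| = 1 :> C by rewrite normc_def /= expr0n expr1n add0r sqrtr1.
have normcR (r : R) : `|(r%:C)%C| = (`|r|%:C)%C :> C.
  by rewrite normc_def /= expr0n addr0 sqrtr_sqr.
have ReC (f : C -> R) : (forall a b, f (a - b) = f a - f b) ->
    (forall z, (`|f z|%:C)%C <= `|z|) ->
    exists l, forall e, 0 < e -> exists n0, forall n, (n0 <= n)%N -> `|f (x n) - l| < e.
  move=> fB f_le; apply: cauchy_seq_cvg => e e0.
  have e0' : 0 < (e%:C)%C :> C by rewrite -(rmorph0 (real_complex R)) ltcR.
  have [n0 h] := xC _ e0'; exists n0 => m n mn0 nn0.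
  have := h m n mn0 nn0; rewrite cdot_norm => /(le_lt_trans (f_le _)).
  by rewrite ltcR fB.
have [a ha] := ReC (@complex.Re R) (fun z w => raddfB (@complex.Re R) z w) (@normc_ge_Re R).
have [|b hb] := ReC (@complex.Im R) (fun z w => raddfB (@complex.Im R) z w).
  move=> z; have := normc_ge_Re (z * 'i%C); rewrite ReiNIm normrN.
  by rewrite normrM normci mulr1.
pose l : C := ((a%:C)%C + 'i%C * (b%:C)%C).
exists l => e e0.
have [r eE] : exists r, e = (r%:C)%C :> C.
  by exists (complex.Re e); rewrite RRe_real // ger0_real // ltW.
have r0 : 0 < r by move: e0; rewrite eE -(rmorph0 (real_complex R)) ltcR.
have r2 : 0 < r / 2 by lra.
have [[n1 h1] [n2 h2]] := (ha _ r2, hb _ r2).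
exists (maxn n1 n2) => n; rewrite geq_max => /andP[/h1 {}h1 /h2 {}h2].
rewrite cdot_norm (complexE (x n : C)) /l opprD addrACA -mulrBr -!rmorphB /=.
apply: le_lt_trans (ler_normD _ _) _; rewrite normrM normci mul1r.
by rewrite !normcR eE -rmorphD ltcR; lra.
Qed.

(** It serves twice: for the convergence of scalar sequences, and as the space of the gaussian
    cocycle that refutes (GC). *)
Definition scalar_hilbert : hilbert R := Hilbert cdot_complete.

Lemma scalar_hnorm (z : scalar_hilbert) : hnorm z = `|z : C|.
Proof. exact: cdot_norm. Qed.
End ScalarHilbert.

(** * Orthogonal projection onto a closed subspace *)

Section Projection.
Variables (R : realType) (H : hilbert R).
Local Notation C := R[i].
(* [hnorm] of [scalar_hilbert] is the modulus, so this is convergence in C. *)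
Local Notation ccvg := (@hcvg R (scalar_hilbert R)).

Lemma innerNr (x y : H) : inner H x (- y) = - inner H x y.
Proof. by rewrite -scaleN1r innerZr mulN1r. Qed.

Lemma hcvg_inner (x y : nat -> H) l m : hcvg x l -> hcvg y m ->
  ccvg (fun n => inner H (x n) (y n)) (inner H l m).
Proof.
move=> xl ym e e0; have [L0 M0] := (hnorm_ge0 l, hnorm_ge0 m).
have L1 : 0 < hnorm l + 1 by rewrite ltr_wpDl.
have M1 : 0 < hnorm m + 1 by rewrite ltr_wpDl.
have e2 : 0 < e / 2 by rewrite divr_gt0.
have [n1 h1] := xl (e / 2 / (hnorm m + 1)) (divr_gt0 e2 M1).
have [n2 h2] := ym (e / 2 / (hnorm l + 1)) (divr_gt0 e2 L1).
have [n3 h3] := ym 1 ltr01.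
exists (maxn (maxn n1 n2) n3) => n; rewrite !geq_max -andbA => /and3P[/h1{}h1 /h2{}h2 /h3{}h3].
rewrite [dot_norm _ _]scalar_hnorm.
have -> : inner H (x n) (y n) - inner H l m =
    inner H (x n - l) (y n) + inner H l (y n - m).
  by rewrite innerBl innerBr addrA subrK.
have yM : hnorm (y n) <= hnorm m + 1.
  rewrite -[y n](subrK m) [_ + m]addrC; apply: le_trans (hnorm_triangle _ _) _.
  by rewrite lerD2l ltW.
apply: le_lt_trans (ler_normD _ _) _; rewrite [e]splitr.
move: h1 h2; rewrite (ltr_pdivlMr _ _ M1) (ltr_pdivlMr _ _ L1) => h1 h2; apply: ltrD.
  apply: le_lt_trans (cauchy_schwarz _ _) _; apply: le_lt_trans h1.
  by rewrite ler_wpM2l ?hnorm_ge0.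
apply: le_lt_trans (cauchy_schwarz _ _) _; apply: le_lt_trans h2.
by rewrite mulrC ler_wpM2l ?hnorm_ge0 // lerDl.
Qed.

Lemma inv_small (e : C) : 0 < e -> exists n0, forall n, (n0 <= n)%N -> n.+1%:R^-1 < e.
Proof.
move=> e0; have [r eE] : exists r, e = (r%:C)%C :> C.
  by exists (complex.Re e); rewrite RRe_real // ger0_real // ltW.
have r0 : 0 < r by move: e0; rewrite eE -(rmorph0 (real_complex R)) ltcR.
exists (Num.truncn r^-1) => n h; rewrite eE.
have -> : n.+1%:R^-1 = ((n.+1%:R^-1 : R)%:C)%C :> C by rewrite fmorphV /= rmorph_nat.
rewrite ltcR invf_plt ?posrE //; apply: lt_le_trans (truncnS_gt _) _.
by rewrite ler_nat.
Qed.

Let nsq (x : H) : R := complex.Re (inner H x x).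
Let nsqE x : inner H x x = ((nsq x)%:C)%C.
Proof. by rewrite RRe_real // ger0_real // inner_ge0. Qed.
Let nsq_ge0 x : 0 <= nsq x.
Proof. by rewrite -lecR -nsqE inner_ge0. Qed.

(** This is the parallelogram law for x - y and x - z, whose sum is twice the distance vector from
    the midpoint of y and z to x. *)
Let parallelogram (x y z : H) :
  nsq (y - z) = 2 * nsq (x - y) + 2 * nsq (x - z) - 4 * nsq (x - (2^-1 : C) *: (y + z)).
Proof.
apply: (fmorph_inj (real_complex R)).
rewrite rmorphB rmorphD !rmorphM /= !rmorph_nat -!nsqE.
have -> : 4 * inner H (x - (2^-1 : C) *: (y + z)) (x - (2^-1 : C) *: (y + z)) =
    inner H ((x - y) + (x - z)) ((x - y) + (x - z)).
  have -> : (x - y) + (x - z) = (2 : C) *: (x - (2^-1 : C) *: (y + z)).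
    by rewrite scalerBr scalerA divff ?pnatr_eq0 // scale1r scaler_nat mulr2n opprD addrACA.
  rewrite [RHS]innerZr innerZl mulrA conjC_nat -natrM //.
have -> : y - z = (x - z) - (x - y) by rewrite opprB [RHS]addrC subrKA.
move: (x - y) (x - z) => a b.
rewrite !(innerBr, innerBl, innerDr, innerDl, innerNr); ring.
Qed.

Lemma csub_projection (V : csub H) x :
  exists2 y, y \in csub_pred V & x - y \in csub_pred (orth V).
Proof.
have [[V0 VD] VZ] := csub_submod V.
have VB a b : a \in csub_pred V -> b \in csub_pred V -> a - b \in csub_pred V.
  by move=> Va Vb; rewrite -scaleN1r; apply: VD => //; exact: VZ.
pose A := [set r | exists2 y, y \in csub_pred V & r = nsq (x - y)]%classic.
have A0 : (A !=set0)%classic by exists (nsq (x - 0)), 0.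
have Alb : has_lbound A by exists 0 => r [y _ ->]; exact: nsq_ge0.
pose d := inf A.
have d_le y : y \in csub_pred V -> d <= nsq (x - y).
  by move=> Vy; apply: ge_inf => //; exists y.
have yE n : exists y, y \in csub_pred V /\ nsq (x - y) < d + n.+1%:R^-1.
  have [|r [y Vy ->] h] := @inf_adherent R A n.+1%:R^-1 _ (conj A0 Alb).
    by rewrite invr_gt0.
  by exists y.
pose y n := sval (cid (yE n)).
have yV n : y n \in csub_pred V by rewrite /y; case: cid => z [].
have yd n : nsq (x - y n) < d + n.+1%:R^-1 by rewrite /y; case: cid => z [].
(* The minimizing sequence is Cauchy: midpoints stay in [V], so the parallelogram law bounds the
   squared distance of two late terms by 2 (d + i) + 2 (d + i) - 4 d = 4 i, with i = 1/(n0 + 1). *)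
have [l yl] : exists l, hcvg y l.
  apply: (hcomplete (h := H)) => e e0.
  have [|n0 h] := @inv_small (e ^+ 2 / 4); first by rewrite divr_gt0 // exprn_gt0.
  exists n0 => m n mn0 nn0.
  rewrite -[dot_norm _ _]/(hnorm (y m - y n)) -(ltr_pXn2r (n := 2)) ?nnegrE ?hnorm_ge0 ?ltW //.
  rewrite hnorm_sqr nsqE (parallelogram x).
  have h1 := d_le _ (VZ (2^-1 : C) _ (VD _ _ (yV m) (yV n))).
  have invn k : (n0 <= k)%N -> (k.+1%:R^-1 : R) <= n0.+1%:R^-1.
    by move=> kn; rewrite lef_pV2 ?posrE ?ltr0Sn // ler_nat.
  have ym : nsq (x - y m) <= d + n0.+1%:R^-1 by apply: le_trans (ltW (yd m)) _; rewrite lerD2l invn.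
  have yn : nsq (x - y n) <= d + n0.+1%:R^-1 by apply: le_trans (ltW (yd n)) _; rewrite lerD2l invn.
  apply: (@le_lt_trans _ _ (((4 * n0.+1%:R^-1 : R))%:C)%C); first rewrite lecR.
    move: h1 ym yn; move: (nsq _) (nsq _) (nsq _) (n0.+1%:R^-1) => a b c i. lra.
  by rewrite rmorphM /= fmorphV /= !rmorph_nat mulrC -ltr_pdivlMr // h.
have Vl : l \in csub_pred V by apply: (csub_closed _ yl).
have l_min z : z \in csub_pred V -> inner H (x - l) (x - l) <= inner H (x - z) (x - z).
  move=> Vz; rewrite !nsqE lecR; apply: contraT; rewrite -ltNge => gap.
  have g0 : 0 < nsq (x - l) - nsq (x - z) by rewrite subr_gt0.
  have e0 : 0 < (((nsq (x - l) - nsq (x - z)) / 2)%:C)%C :> C.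
    by rewrite -(rmorph0 (real_complex R)) ltcR divr_gt0.
  have [n1 h1] := inv_small e0.
  have xyl := hcvgB (hcvg_cst x) yl.
  have [n2 h2] := hcvg_inner xyl xyl e0.
  have {h1} := h1 _ (leq_maxl n1 n2); have {h2} := h2 _ (leq_maxr n1 n2).
  set n := maxn n1 n2; rewrite [dot_norm _ _]scalar_hnorm !nsqE -rmorphB /=.
  have -> : n.+1%:R^-1 = ((n.+1%:R^-1 : R)%:C)%C :> C by rewrite fmorphV /= rmorph_nat.
  rewrite normc_def /= expr0n addr0 sqrtr_sqr !ltcR ltr_norml => /andP[h1 h2] h3.
  have := yd n; have := d_le _ Vz; move: h1 h2 h3.
  move: (nsq (x - y n)) (nsq (x - z)) (nsq (x - l)) (n.+1%:R^-1) => a b c i *; exfalso; lra.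
exists l => //; apply/asboolP => z Vz.
have [->|z0] := eqVneq z 0; first by rewrite inner0l.
have zz : 0 < inner H z z by rewrite lt_def inner_ge0 andbT; apply: contra z0 => /eqP/inner_eq0->.
set n := inner H z z in zz *.
have nc : (n^* = n)%R by apply: geC0_conj; apply: ltW.
(* The multiple of [z] is the optimal one: it lowers the squared distance by |<z, x - l>|^2 / <z,
   z>, which minimality forces to be 0. *)
have := l_min (l + (inner H z (x - l) / n) *: z) (VD _ _ Vl (VZ _ _ Vz)).
rewrite opprD addrA; move: (x - l) => w; set p := inner H z w.
rewrite innerBr !innerBl !innerZr !innerZl -/n -/p.
rewrite [inner H w z]innerC -/p.
have -> : ((p / n)^* = p^* / n)%R by rewrite rmorphM /= fmorphV /= nc.
have -> : p / n * (p^*)%R = `|p| ^+ 2 / n by rewrite normCK mulrAC.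
have -> : (p^*)%R / n * p = `|p| ^+ 2 / n by rewrite normCK mulrAC [_ * p]mulrC.
have -> : p / n * ((p^*)%R / n * n) = `|p| ^+ 2 / n.
  by rewrite divfK ?gt_eqF // normCK mulrAC.
rewrite subrr subr0 -subr_ge0 addrAC subrr sub0r oppr_ge0.
rewrite pmulr_lle0 ?invr_gt0 // => p0; apply/eqP; rewrite -normr_eq0 -sqrf_eq0.
by rewrite eq_le p0 exprn_ge0.
Qed.
End Projection.

(** * The mean ergodic theorem *)

Section Cesaro.
Variables (K : numFieldType) (A : algType K).
Implicit Types z s : A.

Definition cesaro z n : A := (n.+1%:R^-1 : K) *: \sum_(k < n.+1) z ^+ k.
(** The average of the geometric sums 1 + z + ... + z^(k-1). It is the polynomial p_n that inverts 1
    - z up to the Cesaro mean, see [cesaro_potE]. *)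
Definition cesaro_pot z n : A :=
  (n.+1%:R^-1 : K) *: \sum_(k < n.+1) \sum_(j < k) z ^+ j.

Lemma cesaro_potE z n : (1 - z) * cesaro_pot z n = 1 - cesaro z n.
Proof.
rewrite /cesaro_pot /cesaro -scalerAr mulr_sumr.
have E1 : 1 = (n.+1%:R^-1 : K) *: \sum_(k < n.+1) (1 : A).
  by rewrite sumr_const card_ord -scaler_nat scalerA mulVf ?pnatr_eq0 // scale1r.
rewrite [X in _ = X - _]E1 -scalerBr -sumrB; congr (_ *: _); apply: eq_bigr => k _.
by rewrite -[1 - z]opprB mulNr -subrX1 opprB.
Qed.

Lemma cesaro_intertwine z z' s n : s * z = z' * s -> s * cesaro_pot z n = cesaro_pot z' n * s.
Proof.
move=> szs; have szX k : s * z ^+ k = z' ^+ k * s.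
  elim: k => [|k IH]; first by rewrite !expr0 mulr1 mul1r.
  by rewrite !exprS mulrA szs -mulrA IH mulrA.
rewrite -scalerAr -scalerAl; congr (_ *: _); rewrite mulr_sumr mulr_suml.
apply: eq_bigr => k _; rewrite mulr_sumr mulr_suml.
by apply: eq_bigr => j _; exact: szX.
Qed.

Lemma cesaro_telescope z n : cesaro z n * (1 - z) = (n.+1%:R^-1 : K) *: (1 - z ^+ n.+1).
Proof.
rewrite -scalerAl; congr (_ *: _).
rewrite -[1 - z ^+ _]opprB subrX1 -mulNr opprB.
rewrite mulr_sumr mulr_suml; apply: eq_bigr => k _.
by rewrite mulrBr mulrBl mulr1 mul1r -exprS -exprSr.
Qed.
End Cesaro.

Section Representation.
Variables (R : realType) (q : R) (N : nat).
Variable st : uq_star q N.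
Local Notation C := R[i].
Local Notation U := (Uq q N).
Local Notation u := (@uq_u R q N).
Variables (H : hilbert R) (pi : star_rep st H).

Let piP := rep_is_star_rep pi.

Lemma rep_lin a c x y : pi a (c *: x + y) = c *: pi a x + pi a y.
Proof. by have [la _] := rep_bounded piP a; rewrite la. Qed.
Lemma rep_addr a x y : pi a (x + y) = pi a x + pi a y.
Proof. by have := rep_lin a 1 x y; rewrite !scale1r. Qed.
Lemma rep_0r a : pi a 0 = 0.
Proof. by apply: (addrI (pi a 0)); rewrite -rep_addr !addr0. Qed.
Lemma rep_scaler a c x : pi a (c *: x) = c *: pi a x.
Proof. by have := rep_lin a c x 0; rewrite rep_0r !addr0. Qed.
Lemma rep_oppr a x : pi a (- x) = - pi a x.
Proof. by rewrite -scaleN1r rep_scaler scaleN1r. Qed.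
Lemma rep_subr a x y : pi a (x - y) = pi a x - pi a y.
Proof. by rewrite rep_addr rep_oppr. Qed.
Lemma rep_addl a b x : pi (a + b) x = pi a x + pi b x.
Proof. by have := rep_linear piP 1 a b x; rewrite !scale1r. Qed.
Lemma rep_0l x : pi 0 x = 0.
Proof. by apply: (addrI (pi 0 x)); rewrite -rep_addl !addr0. Qed.
Lemma rep_scalel c a x : pi (c *: a) x = c *: pi a x.
Proof. by have := rep_linear piP c a 0 x; rewrite rep_0l !addr0. Qed.
Lemma rep_subl a b x : pi (a - b) x = pi a x - pi b x.
Proof. by rewrite rep_addl -scaleN1r rep_scalel scaleN1r. Qed.
Lemma rep_suml I (r : seq I) P (F : I -> U) x :
  pi (\sum_(i <- r | P i) F i) x = \sum_(i <- r | P i) pi (F i) x.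
Proof. by apply: (big_morph (fun a => pi a x)) => [a b|]; rewrite ?rep_addl ?rep_0l. Qed.
Lemma rep_mul a b x : pi (a * b) x = pi a (pi b x). Proof. exact: (repM piP). Qed.
Lemma rep_one x : pi 1 x = x. Proof. exact: (rep1 piP). Qed.

Lemma hcvg_rep a x l : hcvg x l -> hcvg (fun n => pi a (x n)) (pi a l).
Proof.
have [_ [M M0 aM]] := rep_bounded piP a.
by apply: (hcvg_bounded (M := M)) => //; exact: rep_subr.
Qed.

Definition contraction z := forall x, hnorm (pi z x) <= hnorm x.

Lemma contractionX z k : contraction z -> contraction (z ^+ k).
Proof.
move=> zc; elim: k => [|k IH] x; first by rewrite expr0 rep_one.
by rewrite exprS rep_mul (le_trans (zc _)).
Qed.

Lemma fixedX z k x : pi z x = x -> pi (z ^+ k) x = x.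
Proof.
move=> zx; elim: k => [|k IH]; first by rewrite expr0 rep_one.
by rewrite exprS rep_mul IH.
Qed.

Lemma hnorm_sum_le n (F : 'I_n -> H) (M : C) :
  (forall i, hnorm (F i) <= M) -> hnorm (\sum_(i < n) F i) <= n%:R * M.
Proof.
elim: n F => [|n IH] F FM; first by rewrite big_ord0 hnorm0 mul0r.
rewrite big_ord_recr /= -natr1 mulrDl mul1r.
by apply: le_trans (hnorm_triangle _ _) _; rewrite lerD // IH.
Qed.

Lemma contraction_cesaro z n : contraction z -> contraction (cesaro z n).
Proof.
move=> zc x; rewrite rep_scalel hnormZ rep_suml normfV normr_nat ler_pdivrMl ?ltr0Sn //.
by apply: hnorm_sum_le => k; exact: contractionX.
Qed.

Lemma fixed_cesaro z n x : pi z x = x -> pi (cesaro z n) x = x.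
Proof.
move=> zx; rewrite rep_scalel rep_suml.
rewrite (eq_bigr (fun=> x)) => [|k _]; last exact: fixedX.
rewrite sumr_const card_ord (_ : x *+ n.+1 = (n.+1%:R : C) *: x); last by rewrite scaler_nat.
by rewrite scalerA mulVf ?pnatr_eq0 // scale1r.
Qed.

Lemma hcvg_inv_bounded (w : nat -> H) (M : C) :
  (forall n, hnorm (w n) <= M) -> hcvg (fun n => (n.+1%:R^-1 : C) *: w n) 0.
Proof.
move=> wM e e0; have M0 : 0 < M + 1.
  by rewrite ltr_wpDl // (le_trans _ (wM 0%N)) ?hnorm_ge0.
have [n0 h] := inv_small (divr_gt0 e0 M0).
exists n0 => n /h; rewrite ltr_pdivlMr // subr0 => hn.
rewrite -[dot_norm _ _]/(hnorm _) hnormZ normfV normr_nat; apply: le_lt_trans hn.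
by rewrite ler_wpM2l ?invr_ge0 ?ler0n // (le_trans (wM n)) // lerDl.
Qed.

(** If the adjoint of z fixes x, then <z x, x> = <x, x>, hence |z x - x|^2 = |z x|^2 - |x|^2 <=
    0. *)
Lemma fixed_of_adjoint z x : contraction z -> pi (st z) x = x -> pi z x = x.
Proof.
move=> zc zx; apply/eqP; rewrite -subr_eq0; apply/eqP/inner_eq0.
have e1 : inner H (pi z x) x = inner H x x by rewrite (rep_star piP) zx.
have e2 : inner H x (pi z x) = inner H x x.
  by rewrite innerC e1 -innerC.
rewrite innerBl !innerBr e1 e2 subrr subr0; apply/eqP; rewrite eq_le.
rewrite subr_le0 -!hnorm_sqr ler_pXn2r ?nnegrE ?hnorm_ge0 // zc /=.
have := inner_ge0 (pi z x - x).
by rewrite innerBl !innerBr e1 e2 subrr subr0 -!hnorm_sqr.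
Qed.

(* The vectors whose averages tend to 0 form a closed
   subspace containing the range of 1 - z, and its orthogonal complement
   consists of fixed vectors. *)
Lemma mean_ergodic z x : contraction z ->
  exists2 b, pi z b = b & hcvg (fun n => pi (cesaro z n) x) b.
Proof.
move=> zc; pose P : {pred H} := fun a => `[< hcvg (fun n => pi (cesaro z n) a) 0 >].
have Psub : subsemimod_closed P.
  split=> [|c a /asboolP aP]; last first.
    apply/asboolP; rewrite -(scaler0 _ c).
    by have := hcvgZ c aP; congr hcvg; apply/funext => n; rewrite rep_scaler.
  split=> [|a b /asboolP aP /asboolP bP]; apply/asboolP.
    by under eq_fun do rewrite rep_0r; exact: hcvg_cst.
  rewrite -(addr0 0).
  by have := hcvgD aP bP; congr hcvg; apply/funext => n; rewrite rep_addr.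
have Pcl (y : nat -> H) l : (forall n, y n \in P) -> hcvg y l -> l \in P.
  move=> yP yl; apply/asboolP => e e0; have e2 : 0 < e / 2 by rewrite divr_gt0.
  have [k /(_ _ (leqnn _)) hk] := yl _ e2; have /asboolP/(_ _ e2)[n0 h] := yP k.
  exists n0 => n /h; rewrite !subr0 => hn.
  rewrite -[l](subrK (y k)) rep_addr; apply: le_lt_trans (hnorm_triangle _ _) _.
  rewrite [e]splitr; apply: ltrD => //.
  by apply: le_lt_trans (contraction_cesaro n zc _) _; rewrite hnorm_subC.
pose V := CSub Psub Pcl.
have [a /asboolP aP /asboolP bP] := csub_projection V x.
have zb : pi z (x - a) = x - a.
  apply: fixed_of_adjoint => //; apply/eqP; rewrite eq_sym -subr_eq0; apply/eqP.
  (* [w] is 1 - z* applied to x - a. As (1 - z) w lies in [V] and x - a is orthogonal to [V], moving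
     1 - z to the other side gives <w, w> = 0. *)
  apply: inner_eq0; set w := _ - pi _ _.
  have wV : pi (1 - z) w \in csub_pred V.
    apply/asboolP.
    have := @hcvg_inv_bounded (fun n => pi (1 - z ^+ n.+1) w) (hnorm w + hnorm w).
    have -> : (fun n => n.+1%:R^-1 *: pi (1 - z ^+ n.+1) w) =
        (fun n => pi (cesaro z n) (pi (1 - z) w)).
      by apply/funext => n; rewrite -rep_mul cesaro_telescope rep_scalel.
    apply => n; rewrite rep_subl rep_one -[_ - _](addrC (- _)).
    by rewrite (le_trans (hnorm_triangle _ _)) // hnorm_opp lerD2r contractionX.
  have := bP _ wV; rewrite (rep_star piP) -[- z]scaleN1r starD starZ star1 rmorphN1 scaleN1r.
  by rewrite rep_subl rep_one.
exists (x - a) => //; rewrite -[x - a]add0r.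
have := hcvgD aP (hcvg_cst (x - a)); congr hcvg; apply/funext => n.
by rewrite -{1}(fixed_cesaro n zb) -rep_addr addrC subrK.
Qed.

Hypotheses (q_gt0 : 0 < q).

(** The row relation says that the |u_ks^* y|^2 add up to |y|^2 over s, so the adjoint of u_kk is a
    contraction; the Cauchy-Schwarz inequality carries the bound over to u_kk. *)
Lemma contraction_diag k : contraction (u k k).
Proof.
have adj y : hnorm (pi (st (u k k)) y) <= hnorm y.
  rewrite -(ler_pXn2r (n := 2)) ?nnegrE ?hnorm_ge0 // !hnorm_sqr.
  rewrite -{4}[y]rep_one -(uq_star_row q_gt0 st k) rep_suml.
  have -> : inner H y (\sum_(s < N) pi (u k s * st (u k s)) y) =
      \sum_(s < N) inner H (pi (st (u k s)) y) (pi (st (u k s)) y).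
    rewrite /inner linear_sumlz; apply: eq_bigr => s _.
    by rewrite -[LHS]/(inner H y _) rep_mul -[RHS]/(inner H _ _) (rep_star piP) starK.
  rewrite (bigD1 k) //= lerDl; apply: sumr_ge0 => s _; exact: inner_ge0.
move=> x; have [->|x0] := eqVneq (pi (u k k) x) 0; first by rewrite hnorm0 hnorm_ge0.
set z := pi _ x; have z0 : 0 < hnorm z.
  by rewrite lt_def hnorm_ge0 andbT; apply: contra x0 => /eqP/hnorm_eq0 h; rewrite -/z h.
rewrite -(ler_pM2r z0) -[X in X <= _]expr2 hnorm_sqr {1}/z (rep_star piP).
have h : 0 <= inner H x (pi (st (u k k)) z).
  by rewrite -(rep_star piP) inner_ge0.
rewrite -(ger0_norm h); apply: le_trans (cauchy_schwarz _ _) _.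
by rewrite ler_wpM2l ?hnorm_ge0 // adj.
Qed.
End Representation.

(** * Cocycles as limits of coboundaries *)

Section Approximation.
Variables (R : realType) (q : R) (N : nat).
Hypotheses (q_gt0 : 0 < q) (q_lt1 : q < 1).
Variable st : uq_star q N.
Local Notation C := R[i].
Local Notation U := (Uq q N).
Local Notation qC := (real_complex R q : C).
Local Notation u := (@uq_u R q N).
Local Notation eps := (@uq_counit R q N).

(* The bracket is the 2 x 2 quantum minor on rows i, m and columns j, m. *)
Lemma uq_corner_comm (i j m : 'I_N) : (i < m)%N -> (j < m)%N ->
  (u i j * u m m - qC *: (u i m * u m j)) * u m m =
  u m m * (u i j * u m m - qC *: (u i m * u m j)).
Proof.
move=> im jm; have q0 : qC != 0 by rewrite qC_neq0 // gt_eqF.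
have da : u m m * u i j = u i j * u m m + (qC^-1 - qC) *: (u i m * u m j).
  by rewrite (uq_crossE q im jm) subrK.
have bcd : u i m * u m j * u m m = (qC * qC) *: (u m m * (u i m * u m j)).
  by rewrite -mulrA (uq_rowE q m jm) -scalerAr [X in _ *: X]mulrA (uq_colE q m im) -scalerAl scalerA -mulrA.
rewrite mulrBl mulrBr mulrA da mulrDl -scalerAl -scalerAl -scalerAr bcd !scalerA.
rewrite -addrA -scalerBl -scaleNr; congr (_ + _ *: _).
by field.
Qed.

Variables (H : hilbert R) (pi : star_rep st H).
Local Notation cob h a := (pi a h - eps a *: h).

Lemma cob_mul h a b : cob h (a * b) = pi a (cob h b) + eps b *: cob h a.
Proof.
rewrite rep_mul rep_subr rep_scaler rmorphM /= scalerBr scalerA mulrC.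
by rewrite addrA subrK.
Qed.

Definition is_approx (h : nat -> H) (eta : U -> H) : Prop :=
  forall a, hcvg (fun n => cob (h n) a) (eta a).

(** Coboundaries are cocycles and every pi(a) is continuous, so convergence on the u_ij propagates
    to products. For D^-1, the value at D^-1 is - pi(D^-1) applied to the value at D. *)
Lemma cob_limits (h : nat -> H) :
  (forall i j, exists l, hcvg (fun n => cob (h n) (u i j)) l) ->
  exists2 zeta : {linear U -> H}, cocycle pi zeta & is_approx h zeta.
Proof.
move=> hu; have hall : forall a, exists l, hcvg (fun n => cob (h n) a) l.
  apply: uq_ind => [c|a b [la ha] [lb hb]|a b [la ha] [lb hb]|//|[l hl]].
  - have e1 : eps (c *: 1) = c by rewrite linearZ /= rmorph1 mulr1.
    exists 0; under eq_fun do rewrite rep_scalel rep_one e1 subrr.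
    exact: hcvg_cst.
  - exists (la + lb); have := hcvgD ha hb; congr hcvg; apply/funext => n.
    by rewrite rep_addl raddfD /= scalerDl opprD addrACA.
  - exists (pi a lb + eps b *: la).
    have := hcvgD (hcvg_rep pi a hb) (hcvgZ (eps b) ha); congr hcvg; apply/funext => n.
    by rewrite cob_mul.
  - exists (pi (uq_detV q N) (- l)).
    have := hcvg_rep pi (uq_detV q N) (hcvgZ (-1) hl); rewrite scaleN1r; congr hcvg.
    apply/funext => n; rewrite scaleN1r opprB rep_subr -rep_mul uq_detVl rep_one.
    by rewrite counit_det1 uq_counit_detV !scale1r.
pose f a := sval (cid (hall a)).
have fE a : hcvg (fun n => cob (h n) a) (f a) by rewrite /f; case: cid.
have [zeta zE] : exists zeta : {linear U -> H}, zeta =1 f.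
  apply: exists_linear => c a b; apply: (hcvg_unique (fE _)).
  have := hcvgD (hcvgZ c (fE a)) (fE b); congr hcvg; apply/funext => n.
  rewrite rep_addl rep_scalel linearP /= scalerDl opprD addrACA scalerBr.
  by rewrite scalerA.
exists zeta => [a b|a]; rewrite !zE //; apply: (hcvg_unique (fE _)).
have := hcvgD (hcvg_rep pi a (fE b)) (hcvgZ (eps b) (fE a)); congr hcvg.
by apply/funext => n; rewrite cob_mul.
Qed.

Lemma cocycle1 (eta : {linear U -> H}) : cocycle pi eta -> eta 1 = 0.
Proof.
move=> /(_ 1 1); rewrite mul1r rep_one rmorph1 scale1r => /eqP.
by rewrite -subr_eq0 opprD addrA subrr sub0r oppr_eq0 => /eqP.
Qed.

Lemma cocycle_detV (eta : {linear U -> H}) : cocycle pi eta ->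
  eta (uq_detV q N) = - pi (uq_detV q N) (eta (uq_det q N)).
Proof.
move=> ce; have := ce (uq_detV q N) (uq_det q N).
rewrite uq_detVl (cocycle1 ce) counit_det1 scale1r => /esym/eqP.
by rewrite addrC addr_eq0 => /eqP.
Qed.

Lemma cocycle_eq0 (eta : {linear U -> H}) : cocycle pi eta ->
  (forall i j, eta (u i j) = 0) -> forall a, eta a = 0.
Proof.
move=> ce e0; apply: uq_ind => [c|a b ea eb|a b ea eb|//|ed].
- by rewrite linearZ /= (cocycle1 ce) scaler0.
- by rewrite linearD ea eb addr0.
- by rewrite ce ea eb rep_0r scaler0 addr0.
- by rewrite (cocycle_detV ce) ed rep_0r oppr0.
Qed.

Lemma contraction_scale_fixed z y : contraction pi z -> y = qC *: pi z y -> y = 0.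
Proof.
move=> zc yE; apply: hnorm_eq0; apply/eqP; rewrite eq_le hnorm_ge0 andbT.
have q1 : 0 < 1 - qC.
  by rewrite -(rmorph1 (real_complex R)) -rmorphB -(rmorph0 (real_complex R)) ltcR subr_gt0.
rewrite -(pmulr_rle0 _ q1) mulrBl mul1r subr_le0 {1}yE hnormZ.
have q0 : 0 <= qC by rewrite -(rmorph0 (real_complex R)) lecR ltW.
by rewrite ger0_norm // ler_wpM2l.
Qed.

(** On these vectors all generators with an index at least [m] act by the counit, see
    [fixed_from_gen]. They carry what remains of a cocycle after the diagonal entries from [m] on
    have been treated. *)
Definition fixed_from m x := forall k : 'I_N, (m <= k)%N -> pi (u k k) x = x.

Lemma fixed_from0 m : fixed_from m 0.
Proof. by move=> k _; rewrite rep_0r. Qed.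
Lemma fixed_fromD m x y : fixed_from m x -> fixed_from m y -> fixed_from m (x + y).
Proof. by move=> fx fy k mk; rewrite rep_addr fx ?fy. Qed.
Lemma fixed_fromZ m c x : fixed_from m x -> fixed_from m (c *: x).
Proof. by move=> fx k mk; rewrite rep_scaler fx. Qed.
Lemma fixed_fromB m x y : fixed_from m x -> fixed_from m y -> fixed_from m (x - y).
Proof. by move=> fx fy; rewrite -scaleN1r; apply: fixed_fromD => //; exact: fixed_fromZ. Qed.
Lemma fixed_from_lim m x l : (forall n, fixed_from m (x n)) -> hcvg x l -> fixed_from m l.
Proof.
move=> fx xl k mk; apply: (hcvg_unique _ xl).
by have := hcvg_rep pi (u k k) xl; congr hcvg; apply/funext => n; rewrite fx.
Qed.

(** With k the larger index, y = u_ij x satisfies y = u_ij u_kk x = q u_kk y; as u_kk is a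
    contraction and q < 1, y = 0. *)
Lemma fixed_from_offdiag m x (i j : 'I_N) : fixed_from m x -> i != j ->
  (m <= i)%N || (m <= j)%N -> pi (u i j) x = 0.
Proof.
move=> fx ij mij; have [k [ik jk _ rel]] := uq_offdiag q ij.
apply: (contraction_scale_fixed (contraction_diag pi q_gt0 k)).
have mk : (m <= k)%N by lia.
by rewrite -rep_mul -rep_scalel -rel rep_mul fx.
Qed.

Lemma fixed_from_gen m x (i j : 'I_N) : fixed_from m x ->
  (m <= i)%N || (m <= j)%N -> pi (u i j) x = (i == j)%:R *: x.
Proof.
move=> fx mij; have [ij|ij] := eqVneq i j.
  by rewrite -ij scale1r fx //; move: mij; rewrite -ij orbb.
by rewrite scale0r (fixed_from_offdiag fx).
Qed.

(** For i, j < m <= k the commutator of u_kk and u_ij is a multiple of u_ik u_kj, and u_kj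
    annihilates x. *)
Lemma fixed_from_u m x (i j : 'I_N) : fixed_from m x -> fixed_from m (pi (u i j) x).
Proof.
move=> fx; have [mij|] := boolP ((m <= i)%N || (m <= j)%N).
  by rewrite (fixed_from_gen fx mij); exact: fixed_fromZ.
rewrite negb_or -!ltnNge => /andP[im jm] k mk.
have jk : (j < k)%N by lia.
rewrite -rep_mul; have -> : u k k * u i j =
    u i j * u k k + (qC^-1 - qC) *: (u i k * u k j).
  by rewrite (uq_crossE q (_ : i < k)%N jk) ?subrK //; lia.
rewrite rep_addl rep_scalel !rep_mul fx // (fixed_from_offdiag (i := k) fx).
- by rewrite rep_0r scaler0 addr0.
- by rewrite -val_eqE /= gtn_eqF.
- by rewrite mk.
Qed.

Lemma fixed_fromX m x (i : 'I_N) k : fixed_from m x -> fixed_from m (pi (u i i ^+ k) x).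
Proof.
move=> fx; elim: k => [|k IH]; first by rewrite expr0 rep_one.
by rewrite exprS rep_mul; exact: fixed_from_u.
Qed.

Lemma fixed_from_sum m n (F : 'I_n -> H) :
  (forall i, fixed_from m (F i)) -> fixed_from m (\sum_(i < n) F i).
Proof.
move=> fF; apply: (big_ind (fixed_from m)) => //; first exact: fixed_from0.
by move=> x y; exact: fixed_fromD.
Qed.

Lemma fixed_from_cesaro m x (i : 'I_N) n :
  fixed_from m x -> fixed_from m (pi (cesaro (u i i) n) x).
Proof.
move=> fx; rewrite rep_scalel rep_suml; apply: fixed_fromZ.
by apply: fixed_from_sum => k; exact: fixed_fromX.
Qed.

Lemma fixed_from_pot m x (i : 'I_N) n :
  fixed_from m x -> fixed_from m (pi (cesaro_pot (u i i) n) x).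
Proof.
move=> fx; rewrite rep_scalel rep_suml; apply: fixed_fromZ.
apply: fixed_from_sum => k; rewrite rep_suml.
by apply: fixed_from_sum => j; exact: fixed_fromX.
Qed.
End Approximation.

(** * Peeling off one diagonal entry after another *)

Section Peeling.
Variables (R : realType) (q : R) (N : nat).
Hypotheses (q_gt0 : 0 < q) (q_lt1 : q < 1).
Variable st : uq_star q N.
Local Notation C := R[i].
Local Notation U := (Uq q N).
Local Notation qC := (real_complex R q : C).
Local Notation u := (@uq_u R q N).
Local Notation eps := (@uq_counit R q N).
Variables (H : hilbert R) (pi : star_rep st H).
Local Notation cob h a := (pi a h - eps a *: h).
Local Notation fixed_from := (fixed_from pi).

Section Corner.
Variables (m : 'I_N) (eta : {linear U -> H}).
Hypothesis ce : cocycle pi eta.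
Local Notation T := (u m m).
Local Notation v := (eta T).
Local Notation h n := (- pi (cesaro_pot T n) v).

Let eps_T : eps T = 1. Proof. by rewrite uq_counit_u eqxx. Qed.

Lemma contraction_qT : contraction pi (qC *: T).
Proof.
move=> x; rewrite rep_scalel hnormZ; have q0 : 0 <= qC by rewrite -(rmorph0 (real_complex R)) lecR ltW.
have q1 : qC <= 1 by rewrite -(rmorph1 (real_complex R)) lecR ltW.
rewrite ger0_norm // (le_trans (ler_wpM2l q0 (contraction_diag pi q_gt0 m x))) //.
by rewrite ler_piMl ?hnorm_ge0.
Qed.

(** The cocycle identity on both sides of x T = q T x gives x v = - (1 - q T) eta(x). Since x p_n(T)
    = p_n(q T) x, the coboundary at x is eta(x) minus the n-th Cesaro mean of q T at eta(x), and q T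
    has no nonzero fixed vector. *)
Lemma cob_lim_qcomm (x : U) : x * T = qC *: (T * x) -> eps x = 0 ->
  hcvg (fun n => cob (h n) x) (eta x).
Proof.
move=> xT x0; have [b Tb xb] := mean_ergodic (eta x) contraction_qT.
have b0 : b = 0.
  apply: (contraction_scale_fixed q_gt0 q_lt1 (contraction_diag pi q_gt0 m)).
  by rewrite -rep_scalel Tb.
have xv : pi x v = - pi (1 - qC *: T) (eta x).
  have := ce x T; rewrite eps_T scale1r xT linearZ /= ce x0 scale0r addr0.
  by rewrite rep_subl rep_one rep_scalel opprB => ->; rewrite addrK.
rewrite -[eta x]subr0 -b0.
have := hcvgB (hcvg_cst (eta x)) xb; congr hcvg; apply/funext => n.
rewrite x0 scale0r subr0 rep_oppr -rep_mul (cesaro_intertwine (z' := qC *: T)).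
  rewrite rep_mul xv rep_oppr opprK -rep_mul -(@cesaro_intertwine _ _ (qC *: T) (qC *: T)).
    by rewrite cesaro_potE rep_subl rep_one.
  by rewrite mulrBr mulrBl mulr1 mul1r.
by rewrite xT -scalerAl.
Qed.

(** Here x T = T x gives (x - eps(x)) v = - (1 - T) eta(x), so the coboundary at x is eta(x) minus
    the n-th Cesaro mean of T at eta(x); the means may now have a nonzero limit b. *)
Lemma cob_lim_comm (x : U) : x * T = T * x ->
  exists2 b, pi T b = b /\ hcvg (fun n => pi (cesaro T n) (eta x)) b &
    hcvg (fun n => cob (h n) x) (eta x - b).
Proof.
move=> xT; have [b Tb xb] := mean_ergodic (eta x) (contraction_diag pi q_gt0 m).
exists b => //.
have xv : pi x v - eps x *: v = - pi (1 - T) (eta x).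
  have := ce x T; rewrite eps_T scale1r xT ce => /eqP.
  rewrite addrC -subr_eq => /eqP E.
  by rewrite rep_subl rep_one opprB -E [LHS]addrC -addrA addKr.
have := hcvgB (hcvg_cst (eta x)) xb; congr hcvg; apply/funext => n.
rewrite rep_oppr -rep_mul (cesaro_intertwine _ xT) rep_mul scalerN opprK.
rewrite -rep_scaler [RHS]addrC -rep_subr.
have -> : eps x *: v - pi x v = pi (1 - T) (eta x) by rewrite -opprB xv opprK.
rewrite -rep_mul -(@cesaro_intertwine _ _ T T).
  by rewrite cesaro_potE rep_subl rep_one.
by rewrite mulrBr mulrBl mulr1 mul1r.
Qed.

(** The invariant of the induction: it is no condition for k = N, and for k = 0 it makes the cocycle
    vanish on all u_ij. *)
Definition supported_below (k : nat) (zeta : U -> H) :=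
  forall i j, fixed_from k (zeta (u i j)) /\
    ((k <= i)%N || (k <= j)%N -> zeta (u i j) = 0).

Hypothesis nongauss : completely_nongaussian pi.

(** Such a vector lies in [gauss_part pi], and the restriction of pi to that subspace is
    gaussian. *)
Lemma nongauss_eq0 (w : H) : (forall i j, pi (u i j) w = (i == j)%:R *: w) -> w = 0.
Proof.
move=> wu; have vpi := @gauss_invariant _ _ _ st H pi.
have gr : gaussian_rep (restr vpi).
  move=> a Ka [x xG]; apply: val_inj; rewrite (restr_funE vpi).
  by move/asboolP: (xG) => /(_ a Ka) ax; exact: ax.
apply: (nongauss gr); apply/asboolP => a /K1P a0.
have wall : forall a, pi a w = eps a *: w.
  apply: uq_ind => [c|b b' E E'|b b' E E'|i j|E].
  - by rewrite rep_scalel rep_one linearZ /= rmorph1 mulr1.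
  - by rewrite rep_addl E E' raddfD scalerDl.
  - by rewrite rep_mul E' rep_scaler E rmorphM scalerA mulrC.
  - by rewrite wu uq_counit_u.
  - rewrite uq_counit_detV scale1r -[in RHS](rep_one pi w) -(uq_detVl q N) rep_mul E.
    by rewrite counit_det1 scale1r.
by rewrite wall a0 scale0r.
Qed.

Hypothesis supp : supported_below m.+1 eta.

(* On the quantum minors D_ij and on u_im, u_mj the coboundaries of h_n converge
   because these elements (q-)commute with T = u_mm; the remainder takes values
   in the fixed space of T, so nongaussianity kills its value at T. *)
Lemma peel_step : exists (h' : nat -> H) (zeta : {linear U -> H}),
  [/\ cocycle pi zeta, is_approx pi h' zeta & supported_below m (eta \- zeta)].
Proof.
have [suppF supp0] := (fun i j => (supp i j).1, fun i j => (supp i j).2).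
have hF n : fixed_from m.+1 (h n).
  by rewrite -scaleN1r; apply: fixed_fromZ; apply: (fixed_from_pot q_gt0 q_lt1); exact: suppF.
have [w [Tw wlim] Tlim] := cob_lim_comm (erefl (T * T)).
pose D i j := u i j * T - qC *: (u i m * u m j).
have DT (i j : 'I_N) : (i < m)%N -> (j < m)%N -> D i j * T = T * D i j by exact: uq_corner_comm.
have eta_D (zeta : {linear U -> H}) : cocycle pi zeta -> forall i j : 'I_N, (i < m)%N -> (j < m)%N ->
    zeta (D i j) = pi (u i j) (zeta T) + zeta (u i j) - qC *: pi (u i m) (zeta (u m j)).
  move=> cz i j im jm; rewrite linearB linearZ /= !cz eps_T scale1r uq_counit_u.
  by rewrite -val_eqE /= gtn_eqF // scale0r addr0.
have eps_D (i j : 'I_N) : (i < m)%N -> (j < m)%N -> eps (D i j) = (i == j)%:R.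
  move=> im jm; rewrite linearB linearZ /= !rmorphM /= !uq_counit_u eqxx mulr1.
  by rewrite -[i == m]val_eqE /= ltn_eqF // mul0r mulr0 subr0.
have lim_im (i : 'I_N) : (i < m)%N -> hcvg (fun n => cob (h n) (u i m)) (eta (u i m)).
  move=> im; apply: cob_lim_qcomm; first exact: uq_colE.
  by rewrite uq_counit_u -val_eqE /= ltn_eqF.
have lim_mj (j : 'I_N) : (j < m)%N -> hcvg (fun n => cob (h n) (u m j)) (eta (u m j)).
  move=> jm; apply: cob_lim_qcomm; first exact: uq_rowE.
  by rewrite uq_counit_u -val_eqE /= gtn_eqF.
(* The cocycle identity for D_ij is solved for the value at u_ij, all other terms being known to
   converge. *)
have lim_ij (i j : 'I_N) : (i < m)%N -> (j < m)%N ->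
    exists2 b, pi T b = b /\ hcvg (fun n => pi (cesaro T n) (eta (D i j))) b &
    hcvg (fun n => cob (h n) (u i j)) (eta (u i j) - b + pi (u i j) w).
  move=> im jm; have [b bP blim] := cob_lim_comm (DT i j im jm).
  exists b => //.
  have := hcvgD (hcvgB blim (hcvg_rep pi (u i j) Tlim))
    (hcvgZ qC (hcvg_rep pi (u i m) (lim_mj j jm))).
  congr hcvg; last first.
    rewrite eta_D // rep_subr.
    rewrite opprB [LHS]addrAC [X in X + _]addrAC subrK -[X in X + _]addrA.
    rewrite [LHS]addrC subrKA. exact: addrC.
  apply/funext => n; rewrite eps_D // eps_T scale1r !uq_counit_u.
  rewrite -[m == j]val_eqE /= gtn_eqF // scale0r subr0 rep_subr.
  move: (- pi (cesaro_pot T n) v) => x.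
  rewrite /D rep_subl rep_scalel !rep_mul.
  by rewrite opprB [LHS]addrAC [X in X + _]addrAC subrK [LHS]addrC subrKA.
have lim_off (i j : 'I_N) : (m < i)%N || (m < j)%N -> hcvg (fun n => cob (h n) (u i j)) 0.
  move=> mij; under eq_fun => n do rewrite (fixed_from_gen q_gt0 q_lt1 (hF n) mij) uq_counit_u subrr.
  exact: hcvg_cst.
have [zeta cz hz] : exists2 zeta : {linear U -> H}, cocycle pi zeta &
    is_approx pi (fun n => h n) zeta.
  apply: cob_limits => i j.
  have [mij|] := boolP ((m < i)%N || (m < j)%N); first by exists 0; exact: lim_off.
  rewrite negb_or -!leqNgt => /andP[]; rewrite leq_eqVlt => /orP[/eqP/val_inj ->|im].
    rewrite leq_eqVlt => /orP[/eqP/val_inj ->|jm]; first by exists (v - w).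
    by exists (eta (u m j)); exact: lim_mj.
  rewrite leq_eqVlt => /orP[/eqP/val_inj ->|jm].
    by exists (eta (u i m)); exact: lim_im.
  by have [b _ bl] := lim_ij i j im jm; eexists; exact: bl.
exists (fun n => h n), zeta; split=> //.
pose eta' : {linear U -> H} := eta \- zeta.
have ce' : cocycle pi eta'.
  move=> a b; rewrite /eta' /= ce cz rep_subr scalerBr opprD.
  by rewrite addrACA.
have zE i j l : hcvg (fun n => cob (h n) (u i j)) l -> zeta (u i j) = l.
  by move=> hl; apply: (hcvg_unique (hz _)).
have Fw : fixed_from m w.
  have : fixed_from m.+1 w.
    apply: (fixed_from_lim _ wlim) => n; apply: (fixed_from_cesaro q_gt0 q_lt1); exact: suppF.
  move=> Fw k; rewrite leq_eqVlt => /orP[/eqP/val_inj <- //|]; exact: Fw.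
have eT : eta' T = w by rewrite /= (zE _ _ _ Tlim) opprB addrC subrK.
have e_mj (j : 'I_N) : (j < m)%N -> eta' (u m j) = 0 by move=> jm; rewrite /= (zE _ _ _ (lim_mj j jm)) subrr.
have e_im (i : 'I_N) : (i < m)%N -> eta' (u i m) = 0 by move=> im; rewrite /= (zE _ _ _ (lim_im i im)) subrr.
have e_off (i j : 'I_N) : (m < i)%N || (m < j)%N -> eta' (u i j) = 0.
  by move=> mij; rewrite /= (zE _ _ _ (lim_off i j mij)) subr0 supp0.
have e_ij (i j : 'I_N) : (i < m)%N -> (j < m)%N -> exists2 b, fixed_from m b & eta' (u i j) = b - pi (u i j) w.
  move=> im jm; have [b [Tb bl] hl] := lim_ij i j im jm; exists b.
    have Fb : fixed_from m.+1 b.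
      apply: (fixed_from_lim _ bl) => n; apply: (fixed_from_cesaro q_gt0 q_lt1).
      rewrite eta_D //; apply: fixed_fromB.
        by apply: fixed_fromD; first apply: (fixed_from_u q_gt0 q_lt1); exact: suppF.
      by apply: fixed_fromZ; apply: (fixed_from_u q_gt0 q_lt1); exact: suppF.
    by move=> k; rewrite leq_eqVlt => /orP[/eqP/val_inj <- //|]; exact: Fb.
  by rewrite /= (zE _ _ _ hl) opprD opprB addrA addrCA subrr addr0.
have w0 : w = 0.
  apply: nongauss_eq0 => i j.
  have [mij|] := boolP ((m <= i)%N || (m <= j)%N); first exact: (fixed_from_gen q_gt0 q_lt1 Fw mij).
  rewrite negb_or -!ltnNge => /andP[im jm].
  have [b Fb eb] := e_ij i j im jm.
  have eD : eta' (D i j) = b.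
    by rewrite (eta_D eta' ce') // eT eb (e_mj _ jm) rep_0r scaler0 subr0 addrC subrK.
  (* Since T fixes b, the values of [eta'] at D_ij T and T D_ij give D_ij w = delta_ij w. Moreover
     D_ij w = u_ij w, because T w = w and u_mj w = 0. *)
  have := ce' (D i j) T; rewrite DT // ce' eT eD eps_T scale1r eps_D // (Fb m) //.
  rewrite addrC => /addIr ->.
  rewrite /D rep_subl rep_scalel !rep_mul Tw.
  rewrite (fixed_from_offdiag q_gt0 q_lt1 (i := m) (j := j) Fw) ?leqnn //.
    by rewrite rep_0r scaler0 subr0.
  by rewrite -val_eqE /= gtn_eqF.
move=> i j; rewrite -/(eta' (u i j)).
have [mij|] := boolP ((m < i)%N || (m < j)%N).
  by rewrite -[_ (u i j)]/(eta' (u i j)) e_off //; split=> //; exact: fixed_from0.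
rewrite negb_or -!leqNgt => /andP[]; rewrite leq_eqVlt => /orP[/eqP/val_inj ->|im].
  rewrite leq_eqVlt => /orP[/eqP/val_inj ->|jm].
    by rewrite -[_ T]/(eta' T) eT w0; split=> //; exact: fixed_from0.
  by rewrite -[_ (u m j)]/(eta' (u m j)) e_mj //; split=> //; exact: fixed_from0.
rewrite leq_eqVlt => /orP[/eqP/val_inj ->|jm].
  by rewrite -[_ (u i m)]/(eta' (u i m)) e_im //; split=> //; exact: fixed_from0.
rewrite -[_ (u i j)]/(eta' (u i j)); split; last by lia.
have [b Fb ->] := e_ij i j im jm; apply: fixed_fromB => //.
exact: (fixed_from_u q_gt0 q_lt1).
Qed.
End Corner.

Lemma nongaussian_cocycle_approx (eta : {linear U -> H}) :
  completely_nongaussian pi -> cocycle pi eta -> exists h, is_approx pi h eta.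
Proof.
move=> nongauss ce; have supp : supported_below N eta.
  by move=> i j; split=> [k|]; rewrite !(leqNgt N) !ltn_ord.
suff peel k : (k <= N)%N -> forall eta : {linear U -> H}, supported_below k eta ->
  cocycle pi eta -> exists h, is_approx pi h eta by exact: (peel N).
elim: k => [|k IH] kN {}eta {}supp {}ce.
  exists (fun=> 0) => a; rewrite (cocycle_eq0 ce) => [|i j]; last by have [_ ->] := supp i j.
  by under eq_fun do rewrite rep_0r scaler0 subrr; exact: hcvg_cst.
have [h [zeta [cz hz supp']]] := peel_step (m := Ordinal kN) ce nongauss supp.
pose eta' : {linear U -> H} := eta \- zeta.
have ce' : cocycle pi eta'.
  by move=> a b; rewrite /eta' /= ce cz rep_subr scalerBr opprD addrACA.
have [h' hh'] := IH (ltnW kN) eta' supp' ce'.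
(* Coboundaries depend linearly on their vector, so the approximations of [zeta] and of the
   remainder add up. *)
exists (fun n => h n + h' n) => a; rewrite -[eta a](subrK (zeta a)) addrC.
have := hcvgD (hz a) (hh' a); congr hcvg; apply/funext => n.
by rewrite rep_addr scalerDr opprD addrACA.
Qed.
End Peeling.

(** * Functionals of limits of coboundaries *)

Section NonGaussian.
Variables (R : realType) (q : R) (N : nat).
Hypotheses (q_gt0 : 0 < q) (q_lt1 : q < 1).
Variable st : uq_star q N.
Local Notation C := R[i].
Local Notation U := (Uq q N).
Local Notation qC := (real_complex R q : C).
Local Notation u := (@uq_u R q N).
Local Notation eps := (@uq_counit R q N).
Local Notation ccvg := (@hcvg R (scalar_hilbert R)).

Definition cobounds (psi : U -> C) (theta : U -> U -> C) :=
  forall a b, psi (a * b) = eps a * psi b + psi a * eps b + theta a b.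

Lemma cobounds1 psi theta : cobounds psi theta -> theta 1 1 = 0 -> psi 1 = 0.
Proof.
move=> h t0; have := h 1 1; rewrite mulr1 rmorph1 mul1r mulr1 t0 addr0 => /eqP.
by rewrite -subr_eq0 opprD addrA subrr sub0r oppr_eq0 => /eqP.
Qed.

(** Applying [psi] to the q-commutation gives psi(u_ij) + theta(u_ij, u_kk) = q (psi(u_ij) +
    theta(u_kk, u_ij)), which is solvable because q < 1. *)
Lemma cobounds_offdiag psi theta (i j k : 'I_N) : cobounds psi theta -> scalar psi -> i != j ->
  u i j * u k k = qC *: (u k k * u i j) ->
  psi (u i j) = (1 - qC)^-1 * (qC * theta (u k k) (u i j) - theta (u i j) (u k k)).
Proof.
move=> h sp ij /(congr1 psi); rewrite -[qC *: _]addr0 sp.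
have -> : psi 0 = 0.
  by have := sp (-1) 0 0; rewrite scaler0 addr0 mulN1r addNr.
rewrite addr0 !h !uq_counit_u eqxx (negPf ij) !(mul0r, mulr0, mul1r, mulr1, add0r, addr0).
move=> E; apply: (mulfI (one_sub_qC_neq0 q_lt1)).
rewrite mulrA divff ?one_sub_qC_neq0 // mul1r mulrBl mul1r.
apply: (canRL (addrK _)); rewrite addrAC E; ring.
Qed.

Variables (H : hilbert R) (pi : star_rep st H).
Local Notation cob h a := (pi a h - eps a *: h).

Lemma cob_cobounds h : cobounds (fun a => inner H h (cob h a))
  (fun a b => inner H (cob h (st a)) (cob h b)).
Proof.
move=> a b; rewrite cob_mul innerDr innerZr innerBl innerZl (counit_star q_gt0 q_lt1) conjCK.
rewrite (rep_star (rep_is_star_rep pi)) starK mulrC; ring.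
Qed.

Lemma cob_scalar h : scalar (fun a => inner H h (cob h a)).
Proof.
move=> c a b; rewrite rep_addl rep_scalel linearP /= !innerBr innerDr !innerZr.
ring.
Qed.

(** The derivations d_m of [uq_jets] have coboundary 0 and take the value delta_im at u_ii, so
    subtracting the sum of the psi(u_mm) d_m changes only the values, not [theta]. *)
Lemma normalized_cobounds psi theta : scalar psi -> cobounds psi theta ->
  exists2 psi' : U -> C, scalar psi' & cobounds psi' theta /\ forall i, psi' (u i i) = 0.
Proof.
move=> sp h; have der m : exists d : {scalar U},
    (forall a b, d (a * b) = eps a * d b + d a * eps b) /\
    forall i j, d (u i j) = ((i == j) && (i == m))%:R.
  by have [d [_ [? _ ? _]]] := uq_jets q m; exists d.
pose d m := sval (cid (der m)).
have dM m a b : d m (a * b) = eps a * d m b + d m a * eps b.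
  by rewrite /d; case: cid => ? [].
have du m i j : d m (u i j) = ((i == j) && (i == m))%:R.
  by rewrite /d; case: cid => ? [].
exists (fun a => psi a - \sum_m psi (u m m) * d m a) => [c a b|].
  have -> : \sum_m psi (u m m) * d m (c *: a + b) =
      c * (\sum_m psi (u m m) * d m a) + \sum_m psi (u m m) * d m b.
    rewrite mulr_sumr -big_split; apply: eq_bigr => m _ /=.
    rewrite linearP /=; ring.
  by rewrite sp; ring.
split=> [a b|i].
  have -> : \sum_m psi (u m m) * d m (a * b) =
      eps a * (\sum_m psi (u m m) * d m b) + (\sum_m psi (u m m) * d m a) * eps b.
    rewrite mulr_sumr mulr_suml -big_split; apply: eq_bigr => m _ /=.
    by rewrite dM; ring.
  by rewrite h; ring.
rewrite (bigD1 i) //= du !eqxx mulr1 big1 ?addr0 ?subrr // => m mi.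
by rewrite du eqxx eq_sym (negPf mi) mulr0.
Qed.

(* The functionals of the approximating coboundaries need not converge. Once they
   are normalized by derivations to vanish on the u_ii, they do: on u_ij with
   i <> j they are determined by [theta], see [cobounds_offdiag]. *)
Lemma approx_schurmann (h : nat -> H) (eta : {linear U -> H}) :
  cocycle pi eta -> is_approx pi h eta ->
  exists psi : {scalar U}, schurmann_triple pi eta psi.
Proof.
move=> ce he.
pose theta n a b := inner H (cob (h n) (st a)) (cob (h n) b).
have theta_lim a b : ccvg (fun n => theta n a b) (inner H (eta (st a)) (eta b)).
  by apply: hcvg_inner; exact: he.
have psiE n := normalized_cobounds (cob_scalar (h n)) (cob_cobounds (h n)).
pose psi n : U -> C := s2val (cid2 (psiE n)).
have psi_lin n : scalar (psi n) by rewrite /psi; case: cid2.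
have psi_cob n : cobounds (psi n) (theta n) by rewrite /psi; case: cid2 => ? ? [].
have psi_diag n i : psi n (u i i) = 0 by rewrite /psi; case: cid2 => ? ? [].
have theta1 n : theta n 1 1 = 0.
  by rewrite /theta rep_one rmorph1 scale1r subrr inner0r.
have psi1 n : psi n 1 = 0 by apply: (cobounds1 (psi_cob n)).
have psi0 n : psi n 0 = 0.
  by have := psi_lin n (-1) 0 0; rewrite scaler0 addr0 mulN1r addNr.
have psi_lim : forall a, exists l, ccvg (fun n => psi n a) l.
  apply: uq_ind => [c|a b [la ha] [lb hb]|a b [la ha] [lb hb]|i j|[l hl]].
  - exists 0; have -> : (fun n => psi n (c *: 1)) = fun=> 0.
      by apply/funext => n; rewrite -[c *: 1]addr0 psi_lin psi1 psi0 mulr0 addr0.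
    exact: hcvg_cst.
  - exists (la + lb); have := hcvgD ha hb; congr hcvg; apply/funext => n.
    by rewrite -{2}[a]scale1r psi_lin mul1r.
  - exists (eps a * lb + eps b * la + inner H (eta (st a)) (eta b)).
    have := hcvgD (hcvgD (hcvgZ (eps a) hb) (hcvgZ (eps b) ha)) (theta_lim a b).
    congr hcvg; apply/funext => n; rewrite psi_cob.
    by congr (_ + _ + _); exact: mulrC.
  - have [->|ij] := eqVneq i j.
      by exists 0; under eq_fun do rewrite psi_diag; exact: hcvg_cst.
    have [k [_ _ _ rel]] := uq_offdiag q ij; eexists.
    have := hcvgZ (1 - qC)^-1 (hcvgB (hcvgZ qC (theta_lim (u k k) (u i j)))
      (theta_lim (u i j) (u k k))).
    congr hcvg; apply/funext => n.
    by rewrite (cobounds_offdiag (psi_cob n) (psi_lin n) ij rel).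
  (* As D^-1 D = 1 and the functionals vanish at 1, the value at D^-1 is determined by the value at
     D and by [theta]. *)
  - exists (- (l + inner H (eta (st (uq_detV q N))) (eta (uq_det q N)))); rewrite -mulN1r.
    have := hcvgZ (-1) (hcvgD hl (theta_lim (uq_detV q N) (uq_det q N))).
    congr hcvg; apply/funext => n.
    have := psi_cob n (uq_detV q N) (uq_det q N).
    rewrite uq_detVl psi1 counit_det1 uq_counit_detV mul1r mulr1 addrAC => /esym/eqP.
    by rewrite addrC addr_eq0 => /eqP ->; exact: mulN1r.
pose f a : C := sval (cid (psi_lim a)).
have fE a : ccvg (fun n => psi n a) (f a) by rewrite /f; case: cid.
have [psil psilE] : exists g : {scalar U}, g =1 f.
  apply: exists_scalar => c a b; apply: (hcvg_unique (fE _)).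
  have := hcvgD (hcvgZ c (fE a)) (fE b); congr hcvg; apply/funext => n.
  by rewrite psi_lin.
exists psil; split=> // a b; rewrite !psilE.
have -> : f (st a * b) = eps (st a) * f b + eps b * f (st a) + inner H (eta a) (eta b).
  apply: (hcvg_unique (fE _)); have tl := theta_lim (st a) b; rewrite starK in tl.
  have := hcvgD (hcvgD (hcvgZ (eps (st a)) (fE b)) (hcvgZ (eps b) (fE (st a)))) tl.
  congr hcvg; apply/funext => n; rewrite psi_cob.
  by congr (_ + _ + _); exact: mulrC.
by ring.
Qed.

End NonGaussian.

Lemma uq_property_NC (R : realType) (q : R) (N : nat) (st : uq_star q N) :
  0 < q -> q < 1 -> property_NC st.
Proof.
move=> q_gt0 q_lt1 H pi eta ng ce.
have [h he] := nongaussian_cocycle_approx q_gt0 q_lt1 ng ce.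
exact: (approx_schurmann q_gt0 q_lt1 ce he).
Qed.

(** * The decomposition *)

Section Splitting.
Variables (R : realType) (H : hilbert R) (V : csub H).

Lemma csub_valP (W : csub H) c (x y : csub_type W) :
  csub_val (c *: x + y) = c *: csub_val x + csub_val y.
Proof. exact: (linearP (val : csub_type W -> H)). Qed.

Lemma csub_valB (W : csub H) (x y : csub_type W) :
  csub_val (x - y) = csub_val x - csub_val y.
Proof. exact: (raddfB (val : csub_type W -> H)). Qed.

Lemma orth_inner (x y : H) : x \in csub_pred V -> y \in csub_pred (orth V) ->
  inner H x y = 0.
Proof. by move=> Vx /asboolP; apply. Qed.

Lemma csub_orth0 (x : H) : x \in csub_pred V -> x \in csub_pred (orth V) -> x = 0.
Proof. by move=> Vx Ox; apply: inner_eq0; exact: orth_inner. Qed.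

(** The uniqueness clause makes the projections linear, and it lets identities such as the cocycle
    rule be split into components. *)
Lemma csub_splitting : exists (p : {linear H -> csub_hilbert V})
    (p' : {linear H -> csub_hilbert (orth V)}),
  (forall x, x = csub_val (p x) + csub_val (p' x)) /\
  (forall x (g : csub_hilbert V) (n : csub_hilbert (orth V)),
     x = csub_val g + csub_val n -> p x = g /\ p' x = n).
Proof.
have ex x : exists gn : csub_type V * csub_type (orth V),
    x = csub_val gn.1 + csub_val gn.2.
  have [y Vy Oy] := csub_projection V x.
  by exists (CSubType Vy, CSubType Oy); rewrite /= addrC subrK.
pose f x := sval (cid (ex x)).
have fE x : x = csub_val (f x).1 + csub_val (f x).2 by rewrite /f; case: cid.
have uniq (g g' : csub_type V) (n n' : csub_type (orth V)) :
    csub_val g + csub_val n = csub_val g' + csub_val n' -> g = g' /\ n = n'.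
  move=> E; have E' : csub_val (g - g') = csub_val (n' - n).
    rewrite !csub_valB; apply/eqP.
    by rewrite subr_eq addrAC eq_sym subr_eq E addrC.
  have g0 : csub_val (g - g') = 0.
    by apply: csub_orth0; [exact: (valP (g - g'))|rewrite E'; exact: (valP (n' - n))].
  split; apply/eqP; rewrite -subr_eq0; first by apply/eqP/val_inj.
  by rewrite -oppr_eq0 opprB; apply/eqP/val_inj; rewrite -[LHS]E' g0.
have lin c x y : (f (c *: x + y)).1 = c *: (f x).1 + (f y).1 /\
    (f (c *: x + y)).2 = c *: (f x).2 + (f y).2.
  apply: uniq; rewrite -fE {1}(fE x) {1}(fE y) scalerDr addrACA.
  by rewrite !csub_valP.
have [p pE] : exists p : {linear H -> csub_hilbert V}, p =1 (fun x => (f x).1).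
  by apply: exists_linear => c x y; have [] := lin c x y.
have [p' pE'] : exists p : {linear H -> csub_hilbert (orth V)}, p =1 (fun x => (f x).2).
  by apply: exists_linear => c x y; have [] := lin c x y.
exists p, p'; split=> [x|x g n xE]; rewrite pE pE' //.
by apply: uniq; rewrite -fE.
Qed.
End Splitting.

Section LevyKhintchine.
Variables (R : realType) (q : R) (N : nat).
Hypotheses (q_gt0 : 0 < q) (q_lt1 : q < 1).
Variable st : uq_star q N.
Local Notation C := R[i].
Local Notation U := (Uq q N).
Local Notation eps := (@uq_counit R q N).

Lemma schurmann_generating (H : hilbert R) (pi : star_rep st H) eta (psi : {scalar U}) :
  schurmann_triple pi eta psi -> hermitian_functional st psi ->
  generating_functional st psi.
Proof.
move=> [ce tr] hpsi; split=> // [|b /K1P b0].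
  have := tr 1 1; rewrite (cocycle1 ce) inner0r star1 mulr1 rmorph1 mul1r mulr1 => /eqP.
  by rewrite subrr sub0r eq_sym oppr_eq0 => /eqP.
have := tr b b; rewrite b0 (counit_star q_gt0 q_lt1) b0 rmorph0 mulr0 mul0r !subr0 => <-.
exact: inner_ge0.
Qed.

Lemma schurmann_hermitian (H : hilbert R) (pi : star_rep st H) eta (psi : {scalar U}) :
  schurmann_triple pi eta psi ->
  exists psi' : {scalar U}, schurmann_triple pi eta psi' /\ hermitian_functional st psi'.
Proof.
move=> [ce tr].
have [f fE] : exists f : {scalar U}, f =1 (fun a => (psi a + ((psi (st a))^*)%R) / 2).
  apply: exists_scalar => c a b; rewrite starD starZ !linearP /= rmorphD rmorphM /= conjCK.
  ring.
have es := counit_star q_gt0 q_lt1 st.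
exists f; split=> [|a]; last first.
  by rewrite !fE starK rmorphM fmorphV /= conjC_nat rmorphD /= conjCK addrC.
split=> // a b; rewrite !fE starM starK es.
have E1 := tr a b; have := congr1 Num.Def.conjC (tr b a).
rewrite -innerC !rmorphB !rmorphM /= es conjCK => E2.
apply: (mulIf (_ : 2 != 0 :> C)); first by rewrite pnatr_eq0.
rewrite mulr_natr mulr2n {1}E1 E2 es; by field.
Qed.

Lemma csub_restr (H : hilbert R) (pi : star_rep st H) (V : csub H)
  (Vpi : Defs.invariant pi V) a (x : csub_hilbert V) :
  csub_val (restr Vpi a x) = pi a (csub_val x).
Proof. exact: restr_funE. Qed.

(** [psiL] comes from (NC) for the part of [eta] orthogonal to [gauss_part pi]. The difference [psi]
    - [psiL] then belongs to the gaussian part, since mixed inner products of the two components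
    vanish. *)
Lemma uq_property_LK : property_LK st.
Proof.
move=> psi gpsi H pi eta [ce tr] _.
set Hg := gauss_part pi.
have ginv : Defs.invariant pi Hg := @gauss_invariant _ _ _ _ _ pi.
have ninv : Defs.invariant pi (orth Hg) := orth_invariant ginv.
have [p [p' [pE p_uniq]]] := csub_splitting Hg.
pose etaG : {linear U -> csub_hilbert Hg} := p \o eta.
pose etaN : {linear U -> csub_hilbert (orth Hg)} := p' \o eta.
have etaE a : eta a = csub_val (etaG a) + csub_val (etaN a) by exact: pE.
have cGN a b : etaG (a * b) = restr ginv a (etaG b) + eps b *: etaG a /\
    etaN (a * b) = restr ninv a (etaN b) + eps b *: etaN a.
  apply: p_uniq; rewrite ce etaE [eta a]etaE.
  rewrite -[restr ginv _ _ + _]addrC -[restr ninv _ _ + _]addrC !csub_valP !csub_restr.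
  by rewrite rep_addr scalerDr [LHS]addrC addrACA.
(* A vector in a gaussian invariant subspace of the complement lies in [gauss_part pi] and is
   orthogonal to it. *)
have ng : completely_nongaussian (restr ninv).
  move=> W Winv gW x xW; apply/val_inj/(csub_orth0 (V := Hg)); last exact: valP.
  apply/asboolP => a Ka; rewrite -(csub_restr ninv).
  have := gW a Ka (CSubType xW) => /(congr1 (fun y => csub_val y)); rewrite csub_restr => ax.
  by rewrite [restr _ _ _]ax.
have cG : cocycle (restr ginv) etaG by move=> a b; have [] := cGN a b.
have cN : cocycle (restr ninv) etaN by move=> a b; have [] := cGN a b.
have [psi0 tr0] := uq_property_NC q_gt0 q_lt1 ng cN.
have [psiL [trL hL]] := schurmann_hermitian tr0.
pose psiG : {scalar U} := psi \- psiL.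
have trG : schurmann_triple (restr ginv) etaG psiG.
  split=> // a b; have := tr a b; rewrite etaE [eta b]etaE innerDl !innerDr.
  have o x y : inner H (csub_val (etaG x)) (csub_val (etaN y)) = 0.
    by apply: (orth_inner (V := Hg)); exact: valP.
  rewrite o [inner H (csub_val (etaN a)) (csub_val (etaG b))]innerC o rmorph0.
  rewrite addr0 add0r => E; have E' := trL.2 a b.
  rewrite -[inner _ (etaG a) (etaG b)]/(inner H (csub_val (etaG a)) (csub_val (etaG b))).
  rewrite -[inner _ (etaN a) (etaN b)]/(inner H (csub_val (etaN a)) (csub_val (etaN b))) in E'.
  rewrite (canRL (addrK _) E) E' /=; ring.
have hG : hermitian_functional st psiG.
  by have [hpsi _ _] := gpsi; move=> a; rewrite /= hpsi hL rmorphB.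
exists psiG, psiL; split=> [||a|].
- exact: schurmann_generating trG hG.
- exact: schurmann_generating trL hL.
- by rewrite /= subrK.
- by exists etaG, etaN.
Qed.
End LevyKhintchine.

(** * Gaussian cocycles *)

Section GaussianOne.
Variables (R : realType) (q : R).
Hypotheses (q_gt0 : 0 < q) (q_lt1 : q < 1).
Variable st : uq_star q 1.
Local Notation U := (Uq q 1).
Local Notation u := (@uq_u R q 1).

Lemma gaussian_repE (N : nat) (s : uq_star q N) (H : hilbert R) (pi : star_rep s H) :
  gaussian_rep pi -> forall a x, pi a x = @uq_counit R q N a *: x.
Proof.
move=> gpi a x; have /gpi/(_ x) : K 1 (a - uq_counit a *: 1).
  by apply/K1P; rewrite linearB linearZ /= rmorph1 mulr1 subrr.
by rewrite rep_subl rep_scalel rep_one => /eqP; rewrite subr_eq0 => /eqP.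
Qed.

Lemma property_GC_one : property_GC st.
Proof.
move=> H pi eta gpi ce _; have piE := gaussian_repE gpi.
have [d [c [dM cM du dV]]] := uq_jets q (ord0 : 'I_1).
have d1 : d 1 = 0.
  have := dM 1 1; rewrite mulr1 rmorph1 mul1r mulr1 => /eqP.
  by rewrite -subr_eq0 opprD addrA subrr sub0r oppr_eq0 => /eqP.
have dD : d (uq_det q 1) = 1.
  have := dM (uq_detV q 1) (uq_det q 1).
  rewrite uq_detVl d1 counit_det1 uq_counit_detV dV mulr1 mul1r => /esym/eqP.
  by rewrite subr_eq0 => /eqP.
have es := counit_star q_gt0 q_lt1 st.
set v := eta (u ord0 ord0).
have etaE : forall a, eta a = d a *: v.
  apply: uq_ind => [k|a b ea eb|a b ea eb|i j|ed].
  - by rewrite !linearZ /= (cocycle1 ce) d1 scaler0 mulr0 scale0r.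
  - by rewrite !linearD ea eb scalerDl.
  - by rewrite ce piE ea eb !scalerA -scalerDl dM [d a * _]mulrC.
  - by rewrite !ord1 du eqxx scale1r.
  - by rewrite (cocycle_detV ce) ed piE uq_counit_detV dD dV !scale1r scaleN1r.
have dst : forall a, d (st a) = - ((d a)^*)%R.
  apply: uq_ind => [k|a b ea eb|a b ea eb|i j|_].
  - by rewrite starZ star1 !linearZ /= d1 !mulr0 rmorph0 oppr0.
  - by rewrite starD !linearD /= ea eb rmorphD opprD.
  - by rewrite starM !dM !es ea eb rmorphD !rmorphM; ring.
  - rewrite !ord1 du eqxx rmorph1; have := uq_star_row q_gt0 st ord0.
    rewrite big_ord1 => /(congr1 d); rewrite dM d1 du eqxx es uq_counit_u eqxx.
    by rewrite !rmorph1 !mul1r => /eqP; rewrite addr_eq0 => /eqP h; exact: h.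
  - by rewrite star_detV dD dV rmorphN1 opprK.
have [psi psiE] : exists f : {scalar U}, f =1 (fun a => - inner H v v * c a).
  by apply: exists_scalar => k a b; rewrite linearP /=; ring.
exists psi; split=> // a b; rewrite !psiE cM dst !etaE innerZl innerZr; ring.
Qed.
End GaussianOne.

(** * Failure of (GC) for N at least 2 *)

Section GaussianMany.
Variables (R : realType) (q : R) (N : nat).
Hypotheses (q_gt0 : 0 < q) (q_lt1 : q < 1).
Variable st : uq_star q N.
Local Notation C := R[i].
Local Notation U := (Uq q N).
Local Notation u := (@uq_u R q N).
Local Notation eps := (@uq_counit R q N).
Local Notation H := (scalar_hilbert R).

Fact counit_is_star_rep : is_star_rep st (fun a (x : H) => eps a *: x).
Proof.
split=> [a|c a b x|x|a b x|a x y].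
- split=> [c x y|]; first by rewrite scalerDr !scalerA mulrC.
  by exists `|eps a| => // x; rewrite hnormZ.
- by rewrite linearP /= scalerDl scalerA.
- by rewrite rmorph1 scale1r.
- by rewrite rmorphM scalerA.
- by rewrite innerZl innerZr (counit_star q_gt0 q_lt1).
Qed.

Definition counit_rep : star_rep st H := StarRep counit_is_star_rep.

Lemma derivation_gaussian (eta : {linear U -> H}) : cocycle counit_rep eta -> gaussian_cocycle eta.
Proof.
move=> ce a [m [c [b [b0 ->]]]]; rewrite linear_sum big1 //= => i _.
by rewrite linearZ /= !big_ord_recl big_ord0 mulr1 ce /= !b0 !scale0r addr0 scaler0.
Qed.

(** The cocycle, a derivation here, is applied to the row relation; for s different from k both
    factors u_ks and u_ks^* have counit 0, so these terms vanish. *)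
Lemma gaussian_star_diag (eta : {linear U -> H}) (k : 'I_N) : cocycle counit_rep eta ->
  eta (st (u k k)) = - eta (u k k).
Proof.
move=> ce; have := congr1 eta (uq_star_row q_gt0 st k).
rewrite (cocycle1 ce) linear_sum /= (bigD1 k) //= big1 => [|s sk].
  rewrite addr0 ce /= (counit_star q_gt0 q_lt1) uq_counit_u eqxx !rmorph1 !scale1r => /eqP.
  by rewrite addr_eq0 => /eqP.
rewrite ce /= (counit_star q_gt0 q_lt1) uq_counit_u eq_sym (negPf sk).
by rewrite !rmorph0 !scale0r addr0.
Qed.

(* For the gaussian cocycle d_0 + i d_1 the cross relation between u_00 and u_11
   would force <1, i> = <i, 1>. *)
Lemma property_GC_le1 : property_GC st -> (N <= 1)%N.
Proof.
move=> gc; rewrite leqNgt; apply/negP => N2.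
pose i0 : 'I_N := Ordinal (ltnW N2); pose i1 : 'I_N := Ordinal N2.
have [d0 [_ [d0M _ d0u _]]] := uq_jets q i0.
have [d1 [_ [d1M _ d1u _]]] := uq_jets q i1.
have [eta etaE] : exists f : {linear U -> H}, f =1 (fun a => d0 a + 'i * d1 a : C).
  apply: exists_linear => k a b; rewrite !linearP /=.
  by rewrite -[_ *: _]/(k * _); ring.
have ce : cocycle counit_rep eta.
  move=> a b; rewrite !etaE d0M d1M /= -[_ *: _]/(eps a * _) -[eps b *: _]/(eps b * _).
  ring.
have gpi : gaussian_rep counit_rep by move=> a /K1P a0 x; rewrite /= a0 scale0r.
have [psi [_ tr]] := gc H counit_rep eta gpi ce (derivation_gaussian ce).
have tr' a b : psi (a * b) = inner H (eta (st a)) (eta b) + psi a * eps b + eps a * psi b.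
  by rewrite tr starK; ring.
have /(congr1 psi) := uq_crossE q (erefl : (i0 < i1)%N) (erefl : (i0 < i1)%N).
(* The product u_01 u_10 contributes 0, as both factors have counit 0 and [eta] vanishes at u_10.
   The values of [psi] at u_00 and u_11 cancel, which leaves - i = i. *)
rewrite linearB linearZ /= !tr' !gaussian_star_diag // !uq_counit_u /= !etaE !d0u !d1u /=.
rewrite /inner /= /cdot.
rewrite !(mulr0, mulr1, mul0r, mul1r, addr0, add0r, subr0) rmorphN1 rmorphN /= conjCi opprK.
rewrite mulrN1 -!addrA [psi (u i0 i0) + _]addrC => /addIr /eqP.
by rewrite eq_sym -addr_eq0 -mulr2n mulrn_eq0 /= (negPf (neq0Ci _)).
Qed.
End GaussianMany.

Theorem corollary6p3 (R : realType) (q : R) (N : nat) (st : uq_star q N)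
    (q_gt0 : 0 < q) (q_lt1 : q < 1) (N_ge1 : (1 <= N)%N) :
  [/\ property_NC st, property_LK st & (property_GC st <-> N = 1%N)].
Proof.
split; [exact: uq_property_NC|exact: uq_property_LK|split=> [gc|N1]].
  by apply/eqP; rewrite eqn_leq N_ge1 (property_GC_le1 q_gt0 q_lt1 gc).
by subst N; exact: property_GC_one.
Qed.
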